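(* Let $Q=\begin{pmatrix} Q_{1,1} & Q_{1,2}\\ Q_{2,1} & Q_{2,2}\end{pmatrix}\in L^1_{\mathrm{loc}}(\mathbb{R})^{2\times 2}$ and let $\mathscr{D}=i\sigma_3\frac{d}{dx}+Q(x)$. Then the following statements are equivalent: (i) $\mathscr{D}$ is formally $J$-self-adjoint, i.e. $\mathcal{J}\mathscr{D}\mathcal{J}=\mathscr{D}^*$, in the sense that for every $\Psi\in AC_{\mathrm{loc}}(\mathbb{R})^2$ one has $\sigma_1\overline{\big(\mathscr{D}(\sigma_1\overline{\Psi})\big)}=\mathscr{D}^*\Psi$ a.e. on $\mathbb{R}$; (ii) $Q_{1,1}=Q_{2,2}$ a.e. on $\mathbb{R}$; (iii) for every $z\in\mathbb{C}$, the Wronskian of any pair of linearly independent $z$-wave functions of $\mathscr{D}$ is a nonzero constant (independent of $x\in\mathbb{R}$).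
   Context: $\sigma_1=\begin{pmatrix}0&1\\1&0\end{pmatrix}$, $\sigma_3=\begin{pmatrix}1&0\\0&-1\end{pmatrix}$. $\mathcal{C}$ denotes componentwise complex conjugation on $\mathbb{C}^2$ and $\mathcal{J}=\sigma_1\mathcal{C}$ (a conjugate-linear involution). The formal adjoint of $\mathscr{D}$ is the differential expression $\mathscr{D}^*=i\sigma_3\frac{d}{dx}+Q(x)^*$, where $Q^*$ is the conjugate transpose. A $z$-wave function of $\mathscr{D}$ is a $\Psi\in AC_{\mathrm{loc}}(\mathbb{R})^2$ with $i\sigma_3\Psi'(x)+Q(x)\Psi(x)=z\Psi(x)$ for a.e. $x\in\mathbb{R}$. The Wronskian of $F=(f_1,f_2)^\top$, $G=(g_1,g_2)^\top$ is $W(F(x),G(x))=f_1(x)g_2(x)-f_2(x)g_1(x)$. *)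

(* Defs.v *)
From HB Require Import structures.
From mathcomp Require Import all_boot all_order all_algebra.
From mathcomp Require Import all_classical all_reals all_analysis.
From mathcomp.real_closed Require Import complex.

Set Implicit Arguments.
Unset Strict Implicit.
Unset Printing Implicit Defensive.

Import Order.TTheory GRing.Theory Num.Theory.
Import numFieldNormedType.Exports.
Local Open Scope classical_set_scope.
Local Open Scope ring_scope.
Local Open Scope complex_scope.

Section Dirac.
Variable R : realType.
Local Notation C := (R[i]).
Local Notation mu := (@lebesgue_measure R).

(* Pauli matrices sigma_1, sigma_3 (indices 0,1 stand for 1,2). *)
Definition sigma1 : 'M[C]_2 :=
  \matrix_(i < 2, j < 2) (if i == j then 0 else 1).
Definition sigma3 : 'M[C]_2 :=
  \matrix_(i < 2, j < 2) (if i == j then (if i == 0 then 1 else -1) else 0).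

Definition conjv (v : 'cV[C]_2) : 'cV[C]_2 := map_mx (@conjc R) v.
Definition adjm (M : 'M[C]_2) : 'M[C]_2 := (map_mx (@conjc R) M)^T.

Definition Jop (Psi : R -> 'cV[C]_2) : R -> 'cV[C]_2 :=
  fun x => sigma1 *m conjv (Psi x).

Definition cL1loc (f : R -> C) : Prop :=
  locally_integrable setT (fun x => complex.Re (f x)) /\
  locally_integrable setT (fun x => complex.Im (f x)).

Definition L1loc_mx (Q : R -> 'M[C]_2) : Prop :=
  forall i j : 'I_2, cL1loc (fun x => Q x i j).

Definition abs_cont_on (a b : R) (f : R -> C) : Prop :=
  forall eps : R, 0 < eps -> exists2 delta : R, 0 < delta &
    forall (n : nat) (s t : nat -> R),
      (forall k, (k < n)%N -> a <= s k /\ s k <= t k /\ t k <= b) ->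
      (forall k, (k.+1 < n)%N -> t k <= s k.+1) ->
      \sum_(k < n) (t k - s k) < delta ->
      \sum_(k < n) Normc.normc (f (t k) - f (s k)) < eps.

Definition ACloc (Psi : R -> 'cV[C]_2) : Prop :=
  forall (a b : R) (i : 'I_2), a <= b -> abs_cont_on a b (fun x => Psi x i 0).

(* derivative of a complex-valued function of a real variable, via its real
   and imaginary parts (meaningful where f is differentiable). *)
Definition cderive (f : R -> C) (x : R) : C :=
  (derive1 (fun t => complex.Re (f t)) x) +i* (derive1 (fun t => complex.Im (f t)) x).

Definition vderive (Psi : R -> 'cV[C]_2) (x : R) : 'cV[C]_2 :=
  \col_(i < 2) cderive (fun t => Psi t i 0) x.

Definition Dop (Q : R -> 'M[C]_2) (Psi : R -> 'cV[C]_2) : R -> 'cV[C]_2 :=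
  fun x => 'i *: (sigma3 *m vderive Psi x) + Q x *m Psi x.

Definition Dadj (Q : R -> 'M[C]_2) (Psi : R -> 'cV[C]_2) : R -> 'cV[C]_2 :=
  fun x => 'i *: (sigma3 *m vderive Psi x) + adjm (Q x) *m Psi x.

Definition formally_J_selfadjoint (Q : R -> 'M[C]_2) : Prop :=
  forall Psi : R -> 'cV[C]_2, ACloc Psi ->
    {ae mu, forall x, Jop (Dop Q (Jop Psi)) x = Dadj Q Psi x}.

Definition wave_function (Q : R -> 'M[C]_2) (z : C) (Psi : R -> 'cV[C]_2) : Prop :=
  ACloc Psi /\ {ae mu, forall x, Dop Q Psi x = z *: Psi x}.

Definition wronskian (F G : 'cV[C]_2) : C := F 0 0 * G 1 0 - F 1 0 * G 0 0.

Definition lin_indep2 (Psi Phi : R -> 'cV[C]_2) : Prop :=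
  forall a b : C, (forall x, a *: Psi x + b *: Phi x = 0) -> a = 0 /\ b = 0.

End Dirac.

(* Main.v *)
Require Import Defs.
From HB Require Import structures.
From mathcomp Require Import all_boot all_order all_algebra.
From mathcomp Require Import all_classical all_reals all_analysis.
From mathcomp.real_closed Require Import complex.
From mathcomp Require Import measurable_realfun ring lra zify.
Import Order.TTheory GRing.Theory Num.Theory.
Import numFieldNormedType.Exports.
Set Implicit Arguments.
Unset Strict Implicit.
Unset Printing Implicit Defensive.
Local Open Scope classical_set_scope.
Local Open Scope ring_scope.

(* Conjugation by J replaces [Q] by [sigma1 (conj Q) sigma1], so (i) compares this matrix with
   [Q^*] almost everywhere; testing on a constant vector gives (ii).  A wave function solves
   the linear system [Psi' = B Psi] with [B = - i sigma3 (z - Q)], and the Wronskian satisfies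
   [W' = tr B * W = i (Q11 - Q22) W].  Hence (ii) makes [W] constant, and [W = 0] would make a
   nontrivial combination of the two solutions vanish at a point, hence everywhere by
   uniqueness.  Conversely, solutions with independent initial values exist for [z = 0], and
   constancy of their Wronskian forces [Q11 = Q22].

   The analytic input is that an absolutely continuous function is differentiable almost
   everywhere and is the integral of its derivative.  This follows from a covering argument
   on dyadic intervals, Fatou's lemma and Lebesgue's differentiation theorem.  Uniqueness is
   Gronwall's inequality; existence is Picard iteration with an exponential weight. *)

(** * Absolute continuity and dyadic slopes *)

(** Absolute continuity is given only in epsilon-delta form, while [cderive] has a value even where
    no derivative exists; so existence of the derivative almost everywhere must be established
    before any calculus with the equation. The density of an absolutely continuous [f] therefore
    cannot be introduced as its derivative. It is selected from the dyadic slopes of [f], which are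
    measurable step functions, without knowing that they converge. A one-sided criterion then
    suffices: near almost every point, one cell of almost nonnegative slope is enough for
    monotonicity.

    The differential equation is complex and lives on both sides of the origin. It is turned into a
    real system of size 4, primitives are oriented integrals from 0, and the Picard weight is the
    even function [2 cosh (2 m)] of a primitive [m] of the size of the coefficients; the factor 2
    inside is what makes each Picard step gain 1/2. The parameter [z] enters [B] through
    [- i z sigma3], of trace zero, so the Wronskian satisfies the same equation for every [z]. *)

Section Grid.
Variable R : realType.
Local Notation mu := (@lebesgue_measure R).
Implicit Types (a b h x : R) (f : R -> R) (n k j : nat).

Definition ac_on a b f := forall eps : R, 0 < eps -> exists2 delta : R, 0 < delta &
  forall (n : nat) (s t : nat -> R),
    (forall k, (k < n)%N -> a <= s k /\ s k <= t k /\ t k <= b) ->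
    (forall k, (k.+1 < n)%N -> t k <= s k.+1) ->
    \sum_(k < n) (t k - s k) < delta ->
    \sum_(k < n) `|f (t k) - f (s k)| < eps.

(** The index [k] is unbounded: [j] consecutive blocks of length [h] are cut at level [n] by the
    indices below [j * 2 ^ n]. With blocks of length [h / 2 ^ m], every dyadic point of [[a, a + h]]
    becomes the end of such a chain. *)
Definition grid a h n k := a + k%:R * (h / 2 ^+ n).

Lemma grid0 a h n : grid a h n 0 = a.
Proof. by rewrite /grid mul0r addr0. Qed.

Lemma gridS a h n k : grid a h n k.+1 = grid a h n k + h / 2 ^+ n.
Proof. by rewrite /grid -natr1; ring. Qed.

Lemma grid_double a h n k : grid a h n.+1 k.*2 = grid a h n k.
Proof.
rewrite /grid -muln2 natrM exprS; congr (_ + _).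
have ? : 2 ^+ n != 0 :> R by rewrite expf_neq0.
by field.
Qed.

Lemma grid_last a h n j : grid a h n (j * 2 ^ n) = a + j%:R * h.
Proof.
rewrite /grid natrM natrX; congr (_ + _).
have ? : 2 ^+ n != 0 :> R by rewrite expf_neq0.
by field.
Qed.

Lemma grid_level a h m n k : grid a (h / 2 ^+ m) n k = grid a h (m + n) k.
Proof.
rewrite /grid exprD; congr (_ + _ * _).
have ? : 2 ^+ n != 0 :> R by rewrite expf_neq0.
have ? : 2 ^+ m != 0 :> R by rewrite expf_neq0.
by field; rewrite !expf_neq0.
Qed.

Lemma mesh_gt0 h n : 0 < h -> 0 < h / 2 ^+ n.
Proof. by move=> h0; rewrite divr_gt0// exprn_gt0. Qed.

Lemma mesh_small h d : 0 < h -> 0 < d -> exists n0, forall n, (n0 <= n)%N -> h / 2 ^+ n < d.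
Proof.
move=> h0 d0.
exists (Num.bound (h / d)) => n le_n.
have h1 : h / d < n%:R.
  apply: (lt_le_trans (archi_boundP _)); first by rewrite divr_ge0// ltW.
  by rewrite ler_nat.
have h2 : n%:R < 2 ^+ n :> R by rewrite -natrX ltr_nat ltn_expl.
rewrite ltr_pdivrMr ?exprn_gt0// mulrC -ltr_pdivrMr//.
exact: lt_trans h1 h2.
Qed.

Lemma le_grid a h n k k' : 0 < h -> (grid a h n k <= grid a h n k') = (k <= k')%N.
Proof. by move=> h0; rewrite /grid lerD2l ler_pM2r ?mesh_gt0// ler_nat. Qed.

Lemma lt_grid a h n k k' : 0 < h -> (grid a h n k < grid a h n k') = (k < k')%N.
Proof. by move=> h0; rewrite /grid ltrD2l ltr_pM2r ?mesh_gt0// ltr_nat. Qed.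

Lemma grid_cover a h n j x : a < x -> x <= a + j%:R * h ->
  exists2 k, (k < j * 2 ^ n)%N & grid a h n k < x <= grid a h n k.+1.
Proof.
move=> ax xb.
have ex : exists k, x <= grid a h n k by exists (j * 2 ^ n)%N; rewrite grid_last.
case: (ex_minnP ex) => -[|k]; first by rewrite grid0 leNgt ax.
move=> xk kmin; exists k.
  by apply: kmin; rewrite grid_last.
rewrite xk andbT ltNge; apply/negP => /kmin; by rewrite ltnn.
Qed.

Lemma grid_uniq a h n x k k' : 0 < h ->
  grid a h n k < x <= grid a h n k.+1 -> grid a h n k' < x <= grid a h n k'.+1 -> k = k'.
Proof.
move=> h0 /andP[k1 k2] /andP[k1' k2'].
have := lt_le_trans k1 k2'; rewrite lt_grid// ltnS => kk'.
have := lt_le_trans k1' k2; rewrite lt_grid// ltnS => k'k.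
by apply/eqP; rewrite eqn_leq kk'.
Qed.

Lemma grid_half a h n x k : 0 < h -> grid a h n.+1 k < x <= grid a h n.+1 k.+1 ->
  grid a h n k./2 < x <= grid a h n k./2.+1.
Proof.
move=> h0 /andP[k1 k2]; rewrite -(grid_double a h n k./2) -(grid_double a h n k./2.+1).
apply/andP; split.
  by apply: le_lt_trans k1; rewrite le_grid// -geq_half_double leqnn.
apply: le_trans k2 _; rewrite le_grid// -{1}(odd_double_half k) doubleS !ltnS.
by case: (odd k).
Qed.

Definition cell a h n k : set R := [set` `]grid a h n k, grid a h n k.+1]].

Lemma measurable_cell a h n k : measurable (cell a h n k).
Proof. exact: measurable_itv. Qed.

Lemma lebesgue_cell a h n k : 0 < h -> mu (cell a h n k) = (h / 2 ^+ n)%:E.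
Proof.
move=> h0; rewrite /cell lebesgue_measure_itv/= lte_fin lt_grid// ltnSn.
by rewrite -EFinD gridS addrC addKr.
Qed.

Lemma trivIset_cell a h n : 0 < h -> trivIset setT (cell a h n).
Proof.
move=> h0; apply/trivIsetP => i j _ _ ij; rewrite -subset0 => x [] /=.
by rewrite /cell/= !in_itv/= => xi xj; move/eqP : ij; apply; exact: grid_uniq xi xj.
Qed.

(** Cells outside [P] enter the epsilon-delta condition collapsed to their left endpoint, where they
    add nothing to either sum. Hence one [delta] serves all levels and all selections of cells. *)
Lemma ac_on_grid a h j f : 0 < h -> ac_on a (a + j%:R * h) f ->
  forall eps : R, 0 < eps -> exists2 delta : R, 0 < delta & forall n (P : pred nat),
    \sum_(k < j * 2 ^ n | P k) (h / 2 ^+ n) < delta ->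
    \sum_(k < j * 2 ^ n | P k) `|f (grid a h n k.+1) - f (grid a h n k)| < eps.
Proof.
move=> h0 acf eps /acf[d d0 H]; exists d => // n P smalld.
pose s k := grid a h n k; pose t k := if P k then grid a h n k.+1 else grid a h n k.
have := H (j * 2 ^ n)%N s t.
rewrite [X in _ -> _ -> X < d -> _](_ : _ = \sum_(k < j * 2 ^ n | P k) (h / 2 ^+ n)); last first.
  rewrite [RHS]big_mkcond/=; apply: eq_bigr => k _; rewrite /t /s.
  case: (P k); rewrite ?subrr//.
  by rewrite gridS addrAC subrr add0r.
rewrite [X in _ -> _ -> _ -> X < _](_ : _ =
    \sum_(k < j * 2 ^ n | P k) `|f (grid a h n k.+1) - f (grid a h n k)|); last first.
  rewrite [RHS]big_mkcond/=; apply: eq_bigr => k _; rewrite /t /s.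
  by case: (P k); rewrite ?subrr ?normr0.
apply => //.
- move=> k kn; rewrite /s /t -(grid_last a h n) -{1}(grid0 a h n).
  by case: (P k); rewrite !le_grid//; split => //; split; rewrite // ltnW.
- by move=> k kn; rewrite /s /t; case: (P k); rewrite le_grid.
Qed.

(** Choose [m] so that a cell of level [m] is shorter than the [delta] belonging to [eps = 1]. Every
    finer subdivision of such a cell has variation below 1, so the total stays below [2 ^ m];
    coarser levels have smaller variation by the triangle inequality. *)
Lemma grid_variation_bounded a h f : 0 < h -> ac_on a (a + h) f ->
  exists M, forall n, \sum_(k < 2 ^ n) `|f (grid a h n k.+1) - f (grid a h n k)| <= M.
Proof.
move=> h0 acf; pose V n : R := \sum_(k < 2 ^ n) `|f (grid a h n k.+1) - f (grid a h n k)|.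
have [|d d0 H] := @ac_on_grid a h 1 f h0 _ 1 ltr01; first by rewrite mul1r.
have [m Hm] := mesh_small h0 d0.
exists ((2 ^ m)%:R) => n; rewrite -/(V n).
have V_incr i : V i <= V i.+1.
  rewrite /V -!(big_mkord xpredT (fun k => `|f (grid a h _ k.+1) - f (grid a h _ k)|)).
  rewrite expnS mulnC big_nat_mul/=; apply: ler_sum => k _.
  rewrite big_ltn ?ltn_pmul2r// big_ltn; last by lia.
  rewrite big_geq; last by lia.
  rewrite addr0 muln2 -(grid_double _ _ _ k) -(grid_double _ _ _ k.+1) doubleS.
  by rewrite addrC (le_trans _ (ler_normD _ _))// addrA subrK.
have V_mono i l : V i <= V (l + i)%N.
  by elim: l => [|l IH]//; rewrite addSn (le_trans IH).
apply: (le_trans (V_mono n m)).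
rewrite /V.
rewrite -(big_mkord xpredT (fun k => `|f (grid a h _ k.+1) - f (grid a h _ k)|)).
rewrite expnD big_nat_mul/= big_mkord.
rewrite [leRHS](_ : _ = \sum_(i < 2 ^ m) 1); last by rewrite sumr_const card_ord.
apply: ler_sum => i _.
have mn : (1 * 2 ^ (m + n) = 2 ^ m * 2 ^ n)%N by rewrite mul1n expnD.
have split_sum (F : nat -> R) : \sum_(k < 1 * 2 ^ (m + n) | (i * 2 ^ n <= k < i.+1 * 2 ^ n)%N) F k
   = \sum_(i * 2 ^ n <= k < i.+1 * 2 ^ n) F k.
  rewrite -(big_mkord (fun k => (i * 2 ^ n <= k < i.+1 * 2 ^ n)%N) F).
  rewrite (@big_cat_nat _ _ _ (i * 2 ^ n))//=; last by rewrite mn leq_mul2r ltnW ?orbT.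
  rewrite [X in _ + X](@big_cat_nat _ _ _ (i.+1 * 2 ^ n))//=; last 2 first.
    by rewrite leq_mul2r leqnSn orbT.
    by rewrite mn leq_mul2r ltn_ord orbT.
  rewrite big_nat_cond big_pred0 ?add0r; last by move=> k; lia.
  rewrite [X in _ + X]big_nat_cond [X in _ + X]big_pred0 ?addr0; last by move=> k; lia.
  rewrite big_nat_cond [RHS]big_nat_cond; apply: eq_bigl => k.
  by rewrite andbT andbb.
have := H (m + n)%N (fun k => (i * 2 ^ n <= k < i.+1 * 2 ^ n)%N).
rewrite (split_sum (fun k => `|f (grid a h _ k.+1) - f (grid a h _ k)|)).
rewrite (split_sum (fun=> h / 2 ^+ (m + n))) => {}H; apply/ltW/H.
rewrite sumr_const_nat -mulnBl subSn// subnn mul1n.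
rewrite (_ : _ *+ _ = h / 2 ^+ m) ?Hm//.
rewrite -mulr_natl natrX exprD.
have ? : 2 ^+ n != 0 :> R by rewrite expf_neq0.
have ? : 2 ^+ m != 0 :> R by rewrite expf_neq0.
by field; rewrite !expf_neq0.
Qed.

(* Call a dyadic interval bad when neither it nor any of its ancestors has slope at least
   [- eps].  Descending only into bad intervals loses at most [eps * (b - a)]; the bad
   intervals of level n decrease to a null set, where absolute continuity takes over. *)
Lemma ac_on_grid_le a h j f : 0 < h -> ac_on a (a + j%:R * h) f ->
  {ae mu, forall x, a < x <= a + j%:R * h -> forall eps : R, 0 < eps ->
    exists n k, [/\ (k < j * 2 ^ n)%N, grid a h n k < x <= grid a h n k.+1 &
      - eps * (h / 2 ^+ n) <= f (grid a h n k.+1) - f (grid a h n k)]} ->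
  f a <= f (a + j%:R * h).
Proof.
move=> h0 acf aef.
pose D n k := f (grid a h n k.+1) - f (grid a h n k).
have DS n k : D n k = D n.+1 k.*2 + D n.+1 k.*2.+1.
  by rewrite /D -doubleS 2!grid_double; ring.
suff key (eps : R) : 0 < eps -> - eps * (j%:R * h) - eps <= f (a + j%:R * h) - f a.
  rewrite -subr_ge0; apply/ler_addgt0Pl => e e0.
  have c0 : 0 < j%:R * h + 1 by rewrite ltr_wpDl// mulr_ge0// ltW.
  (* With this value the two losses, [eps] times the length and [eps] itself, add up to [e]. *)
  have := key (e / (j%:R * h + 1)) (divr_gt0 e0 c0).
  rewrite (_ : _ - _ = - e); last by field; rewrite gt_eqF.
  by lra.
move=> eps0.
pose good n k := - eps * (h / 2 ^+ n) <= D n k.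
pose bad := fix bad n k := if n is n'.+1 then bad n' k./2 && ~~ good n k else ~~ good 0 k.
have badS n k : bad n.+1 k = bad n k./2 && ~~ good n.+1 k by [].
(* Below the first good interval of a branch, its lower bound [- eps] times length is shared evenly
   among its descendants; on bad intervals the true increment is kept. Each refinement can then only
   lower the sum. *)
pose E n k := if bad n k then D n k else - eps * (h / 2 ^+ n).
have meshS n : h / 2 ^+ n = h / 2 ^+ n.+1 + h / 2 ^+ n.+1.
  have ? : 2 ^+ n != 0 :> R by rewrite expf_neq0.
  by rewrite exprS; field.
have sumE n : \sum_(0 <= k < j * 2 ^ n) E n k <= f (a + j%:R * h) - f a.
  elim: n => [|n IH].
    rewrite -(grid_last a h 0) -{2}(grid0 a h 0).
    rewrite -(telescope_sumr (fun k => f (grid a h 0 k)))//.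
    apply: ler_sum => k _; rewrite /E /=.
    by case: ifPn => //; rewrite negbK.
  apply: le_trans IH.
  rewrite expnS mulnCA mulnC big_nat_mul/=; apply: ler_sum => k _.
  rewrite big_ltn ?ltn_pmul2r// big_ltn; last by lia.
  rewrite big_geq; last by lia.
  have k2 : k.*2.+1./2 = k by exact: uphalf_double.
  rewrite addr0 muln2 /E !badS k2 doubleK.
  case: (bad n k) => /=; last by rewrite -mulrDr -meshS.
  rewrite (DS n k); apply: lerD; last by case: (boolP (good _ _)).
  by case: (boolP (good _ _)).
pose U n := \big[setU/set0]_(k < j * 2 ^ n | bad n k) cell a h n k.
have mU n : measurable (U n) by apply: bigsetU_measurable => k _; exact: measurable_cell.
have muU n : mu (U n) = (\sum_(k < j * 2 ^ n | bad n k) (h / 2 ^+ n))%:E.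
  rewrite /U measure_bigsetU_ord_cond//.
  - by rewrite -sumEFin; apply: eq_bigr => k _; exact: lebesgue_cell.
  - by move=> k _; exact: measurable_cell.
  - move=> k k' _ _ /(@trivIset_cell a h n h0 k k' I I) kk'; exact: val_inj.
have UP n x : U n x -> exists2 k, (k < j * 2 ^ n)%N & bad n k /\ cell a h n k x.
  rewrite /U -bigcup_seq_cond/= => -[k /andP[_ bk] xk].
  by exists k => //; split.
have PU n x k : (k < j * 2 ^ n)%N -> bad n k -> cell a h n k x -> U n x.
  move=> kn bk xk; rewrite /U -bigcup_seq_cond; exists (Ordinal kn) => //=.
  by rewrite mem_index_enum bk.
have Udecr : nonincreasing_seq U.
  apply/nonincreasing_seqP => n; apply/subsetPset => x /UP[k kn [/=/andP[bk _] xk]].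
  apply: (@PU _ _ k./2) => //; first by rewrite expnS in kn; lia.
  exact: grid_half xk.
(* A point lying in every [U n] has only bad, hence no good, dyadic cells around it. It violates the
   slope hypothesis for this [eps], so it belongs to the exceptional null set. *)
have U0 : mu (\bigcap_n U n) = 0%E.
  apply/negligibleP; first exact: bigcapT_measurable.
  apply: negligibleS aef => x Ux /= H.
  have [k _ [_]] := UP 0%N x (Ux 0%N I); rewrite /cell/= in_itv/= => /andP[x1 x2].
  have {x1 x2}xab : a < x <= a + j%:R * h.
    have [k' k'n [_]] := UP 0%N x (Ux 0%N I); rewrite /cell/= in_itv/= => /andP[y1 y2].
    rewrite (le_lt_trans _ y1)/=; last by rewrite -{1}(grid0 a h 0) le_grid.
    by rewrite (le_trans y2)// -(grid_last a h 0) le_grid.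
  have [n [k' [k'n xk' gk']]] := H xab eps eps0.
  have [i _ [bi]] := UP n x (Ux n I); rewrite /cell/= in_itv/= => xi.
  rewrite (grid_uniq h0 xk' xi) -/(good n i) in gk'.
  by case: n bi {k'n xk' xi H} gk' => [|n]/=; [|case/andP => _]; move=> /negP.
have cvU : mu \o U @ \oo --> 0%E.
  have mU0 : (mu (U 0%N) < +oo)%E by rewrite muU ltry.
  rewrite -U0; apply: nonincreasing_cvg_mu => //.
  exact: bigcapT_measurable.
have [d d0 Hd] := ac_on_grid h0 acf eps0.
have [n Un] : exists n, (mu (U n) < d%:E)%E.
  have cvr : (fun n => \sum_(k < j * 2 ^ n | bad n k) (h / 2 ^+ n)) @ \oo --> (0 : R).
    have /fine_cvgP[_] := cvU.
    by apply: cvg_trans; apply: near_eq_cvg; near=> n; rewrite /= muU.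
  have /= [n _ Hn] := cvgr_lt _ cvr _ d0.
  by exists n; rewrite muU lte_fin; apply: Hn => /=.
rewrite muU lte_fin in Un.
apply: le_trans (sumE n); rewrite big_mkord (bigID (fun k : 'I__ => bad n k))/= addrC.
have := Hd n _ Un => {}Hd.
apply: lerD.
  rewrite (eq_bigr (fun=> - eps * (h / 2 ^+ n))); last by move=> k /negPf; rewrite /E => ->.
  rewrite -mulr_sumr !mulNr lerN2 ler_pM2l//.
  apply: (@le_trans _ _ (\sum_(k < j * 2 ^ n) (h / 2 ^+ n))).
    rewrite [leRHS](bigID (fun k : 'I__ => bad n k))/= lerDr sumr_ge0// => k _.
    by rewrite ltW// mesh_gt0.
  rewrite sumr_const card_ord -[_ *+ (j * 2 ^ n)]mulr_natl natrM natrX.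
  have ? : 2 ^+ n != 0 :> R by rewrite expf_neq0.
  by rewrite (_ : _ * (h / _) = j%:R * h)//; field.
rewrite (eq_bigr (fun k : 'I__ => D n k)); last by move=> k bk; rewrite /E bk.
apply: le_trans (_ : - `|\sum_(k < j * 2 ^ n | bad n k) D n k| <= _); last by rewrite lerNl -normrN ler_norm.
rewrite lerN2; apply/ltW; apply: le_lt_trans Hd; exact: ler_norm_sum.
Unshelve. all: by end_near. Qed.
End Grid.

(** * Absolute continuity of integrals, straddled difference quotients, upper and lower limits *)

Section AbsoluteContinuity.
Variable R : realType.
Local Notation mu := (@lebesgue_measure R).
Implicit Types (a b c x : R) (f g : R -> R).

Lemma ac_onS a b a' b' f : a <= a' -> b' <= b -> ac_on a b f -> ac_on a' b' f.
Proof.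
move=> aa bb acf e /acf[d d0 H]; exists d => // n s t st; apply: H => k /st[sa [-> tb]].
by rewrite (le_trans aa)// (le_trans tb).
Qed.

Lemma ac_onB a b f g : ac_on a b f -> ac_on a b g -> ac_on a b (fun x => f x - g x).
Proof.
move=> acf acg e e0; have e2 : 0 < e / 2 by rewrite divr_gt0.
have [d d0 Hd] := acf _ e2; have [d' d'0 Hd'] := acg _ e2.
exists (Num.min d d'); first by rewrite lt_min d0.
move=> n s t st ts; rewrite lt_min => /andP[sd sd'].
rewrite [ltRHS]splitr; apply: le_lt_trans (ltrD (Hd n s t st ts sd) (Hd' n s t st ts sd')).
rewrite -big_split/=; apply: ler_sum => k _.
rewrite (_ : f (t k) - g (t k) - _ = (f (t k) - f (s k)) - (g (t k) - g (s k))); last by ring.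
exact: ler_normB.
Qed.

Lemma ac_on_cst a b c : ac_on a b (cst c : R -> R).
Proof.
by move=> e e0; exists 1 => // n s t _ _ _; rewrite big1// => k _; rewrite subrr normr0.
Qed.

Lemma ac_on_unif a b f : ac_on a b f -> forall e, 0 < e -> exists2 d, 0 < d &
  forall x y, a <= x -> x <= y -> y <= b -> y - x < d -> `|f y - f x| < e.
Proof.
move=> acf e /acf[d d0 H]; exists d => // x y ax xy yb yx.
by have := H 1%N (fun=> x) (fun=> y); rewrite !big_ord1; apply.
Qed.

Lemma ac_on_integral c a b g : c <= a -> mu.-integrable setT (EFin \o g) ->
  ac_on a b (fun x => \int[mu]_(t in `[c, x]) g t).
Proof.
move=> ca gi e e0; have [d [d0 Hd]] := integral_normr_continuous gi e0.
have gA (A : set R) : measurable A -> mu.-integrable A (EFin \o g).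
  by move=> mA; exact: integrableS gi.
exists d => // n s t st ts sd.
(* Left-open intervals are disjoint even when neighbours share an endpoint, so the increments add up
   to at most the integral of [|g|] over one union of small measure. *)
pose F k : set R := [set` `]s k, t k]].
have mF k : measurable (F k) by exact: measurable_itv.
have tsm k k' : (k < k')%N -> (k' < n)%N -> t k <= s k'.
  elim: k' => // k' IH; rewrite ltnS leq_eqVlt => /predU1P[->|kk'] k'n; first exact: ts.
  have [_ [st' _]] := st k' (ltnW k'n).
  by rewrite (le_trans (IH kk' (ltnW k'n)))// (le_trans st')// ts.
have tF : trivIset [set` index_iota 0 n] F.
  have aux i k x : (i < k)%N -> (k < n)%N -> F i x -> F k x -> False.
    rewrite /F/= !in_itv/= => ik kn /andP[_ xt] /andP[sx _].
    by have := lt_le_trans sx (le_trans xt (tsm _ _ ik kn)); rewrite ltxx.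
  move=> i k /=; rewrite !mem_index_iota/= => ni nk [x [Fi Fk]].
  by case: (ltngtP i k) => // ik; exfalso; [exact: aux ik nk Fi Fk|exact: aux ik ni Fk Fi].
have mg : measurable_fun [set: R] (fun x => `|g x| : R).
  by apply/measurableT_comp => //; apply/measurable_EFinP; exact: measurable_int gi.
have iA (A : set R) : measurable A -> (\int[mu]_(x in A) `|g x|)%:E = (\int[mu]_(x in A) (`|g x|%R : R)%:E)%E.
  move=> mA; rewrite /Rintegral fineK//.
  by apply: integrable_fin_num => //; exact: integrable_abse (gA _ mA).
apply: le_lt_trans (Hd (\big[setU/set0]_(k <- index_iota 0 n) F k) _ _).
- rewrite -lee_fin iA; last exact: bigsetU_measurable.
  rewrite ge0_integral_bigsetU//; [|exact: iota_uniq|exact/measurable_EFinP/measurable_funTS].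
  rewrite big_mkord -sumEFin; apply: lee_sum => k _.
  have [sa [sk tb]] := st k (ltn_ord k).
  rewrite Rintegral_itvB; [|exact: gA|by rewrite bnd_simp (le_trans ca)|by rewrite bnd_simp].
  rewrite -iA// lee_fin; apply: le_normr_Rintegral => //; exact: gA.
- by apply: bigsetU_measurable => k _; exact: mF.
- suff : (mu (\big[setU/set0]_(k <- index_iota 0 n) F k) < d%:E)%E by [].
  have -> : mu (\big[setU/set0]_(k <- index_iota 0 n) F k) = (\sum_(k < n) mu (F k))%E.
    rewrite big_mkord; apply: (@measure_bigsetU_ord_cond _ _ _ mu n xpredT (fun k => F k)).
      by move=> k _; exact: mF.
    by move=> k k' _ _ kk'; apply/val_inj/tF => //=; rewrite mem_index_iota/=.
  apply: le_lt_trans (_ : (\sum_(k < n) (t k - s k))%:E < _)%E; last by rewrite lte_fin.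
  rewrite -sumEFin; apply: lee_sum => k _; rewrite /F lebesgue_measure_itv/= lte_fin.
  by case: ltP => //= _; rewrite lee_fin subr_ge0; case: (st k (ltn_ord k)) => _ [].
Qed.

(** Dyadic cells shrinking to [x] contain it without having it as an endpoint. With the Caratheodory
    quotient [q], the error splits as [(q v - d) (v - x) + (q u - d) (x - u)], whose two lengths add
    up to [v - u]. *)
Lemma is_derive_straddle (G : R -> R) x d : is_derive x 1 G d -> forall e, 0 < e ->
  exists2 r, 0 < r & forall u v, u <= x -> x <= v -> v - u < r ->
    `|G v - G u - d * (v - u)| <= e * (v - u).
Proof.
move=> /is_derive1_caratheodory[q [Gq cq qx]] e e0.
have /cvgrPdist_lt /(_ _ e0)/nbhs_ballP[r /= r0 Hr] := cq.
exists r => // u v ux xv vur.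
have Hq z : `|x - z| < r -> `|q z - d| <= e by move=> /Hr; rewrite qx distrC => /ltW.
have -> : G v - G u - d * (v - u) = (q v - d) * (v - x) + (q u - d) * (x - u).
  by have := Gq v; have := Gq u; lra.
have -> : e * (v - u) = e * (v - x) + e * (x - u) by ring.
apply: (le_trans (ler_normD _ _)); rewrite !normrM; apply: lerD.
  by rewrite (ger0_norm (_ : 0 <= v - x)) ?subr_ge0// ler_wpM2r ?subr_ge0// Hq// ltr_norml; lra.
by rewrite (ger0_norm (_ : 0 <= x - u)) ?subr_ge0// ler_wpM2r ?subr_ge0// Hq// ltr_norml; lra.
Qed.

Lemma limn_esup_ub (u : (\bar R)^nat) (c : \bar R) n0 :
  (forall n, (n0 <= n)%N -> u n <= c)%E -> (limn_esup u <= c)%E.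
Proof.
move=> uc; rewrite limn_esup_lim; apply: lime_le; first exact: is_cvg_esups.
exists n0 => // m /= n0m; apply: ge_ereal_sup => _ [k /= mk <-].
by apply: uc; exact: leq_trans mk.
Qed.

Lemma limn_einf_lb (u : (\bar R)^nat) (c : \bar R) n0 :
  (forall n, (n0 <= n)%N -> c <= u n)%E -> (c <= limn_einf u)%E.
Proof.
move=> uc; rewrite /limn_einf leeNr; apply: (@limn_esup_ub _ _ n0) => n /uc.
by rewrite leeN2.
Qed.

Lemma le_limn_esup (u v : (\bar R)^nat) : (forall n, u n <= v n)%E ->
  (limn_esup u <= limn_esup v)%E.
Proof.
move=> uv; rewrite !limn_esup_lim; apply: lee_lim; [exact: is_cvg_esups..|].
apply: nearW => n; apply: ge_ereal_sup => _ [k /= nk <-].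
by apply: le_trans (uv k) _; apply: ereal_sup_ubound; exists k.
Qed.

Lemma le_limn_einf (u v : (\bar R)^nat) : (forall n, u n <= v n)%E ->
  (limn_einf u <= limn_einf v)%E.
Proof. by move=> uv; rewrite leeN2; apply: le_limn_esup => n; rewrite leeN2. Qed.

(* The point of [[limn_einf u, limn_esup u]] closest to 0. *)
Definition acc_point (u : (\bar R)^nat) : \bar R :=
  maxe (limn_einf u) (mine (limn_esup u) 0%E).

Lemma acc_point_ge (u : (\bar R)^nat) : (limn_einf u <= acc_point u)%E.
Proof. by rewrite /acc_point le_max lexx. Qed.

Lemma acc_point_le (u : (\bar R)^nat) : (acc_point u <= limn_esup u)%E.
Proof. by rewrite /acc_point ge_max limn_einf_sup ge_min lexx. Qed.

(** This bound is the reason for choosing the point closest to 0: its absolute value is controlled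
    by a lower limit, the quantity that Fatou's lemma controls. *)
Lemma abse_acc_point (u : (\bar R)^nat) : (`|acc_point u| <= limn_einf (fun n => `|u n|))%E.
Proof.
set L := limn_einf (fun n => `|u n|)%E.
have L0 : (0 <= L)%E by apply: (@limn_einf_lb _ _ 0%N).
have lL : (limn_einf u <= L)%E by apply: le_limn_einf => n; exact: lee_abs.
have uL : (- L <= limn_esup u)%E.
  rewrite -[leRHS]oppeK leeN2 -limn_einfN; apply: le_limn_einf => n /=.
  by rewrite -abseN; exact: lee_abs.
have gL : (acc_point u <= L)%E by rewrite /acc_point ge_max lL ge_min L0 orbT.
have Lg : (- L <= acc_point u)%E.
  by rewrite /acc_point le_max le_min uL oppe_le0 L0 orbT.
by have [g0|g0] := leP 0%E (acc_point u); [rewrite gee0_abs|rewrite lte0_abs// leeNl].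
Qed.

End AbsoluteContinuity.

(** * Absolutely continuous functions as integrals *)

Section Primitive.
Variable R : realType.
Local Notation mu := (@lebesgue_measure R).
Implicit Types (a b c x : R) (f g : R -> R).

Lemma ae_imply (P Q : R -> Prop) : (forall x, P x -> Q x) ->
  {ae mu, forall x, P x} -> {ae mu, forall x, Q x}.
Proof. by move=> PQ; apply: filterS => //; exact: (ae_filter_ringOfSetsType mu). Qed.

Lemma ae_imply2 (P1 P2 Q : R -> Prop) : (forall x, P1 x -> P2 x -> Q x) ->
  {ae mu, forall x, P1 x} -> {ae mu, forall x, P2 x} -> {ae mu, forall x, Q x}.
Proof. by move=> PQ; apply: filterS2 => //; exact: (ae_filter_ringOfSetsType mu). Qed.

Lemma derivable_is_derive f x (d : R) : derivable f x 1 -> derive1 f x = d -> is_derive x 1 f d.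
Proof. by move=> df <-; rewrite derive1E; exact: derivableP. Qed.

Definition slope f a h n k : R := (f (grid a h n k.+1) - f (grid a h n k)) / (h / 2 ^+ n).

Definition dyadic_slope f a h n x : R :=
  \sum_(k < 2 ^ n) slope f a h n k * \1_(cell a h n k) x.

Lemma dyadic_slopeE f a h n k x : 0 < h -> (k < 2 ^ n)%N -> grid a h n k < x <= grid a h n k.+1 ->
  dyadic_slope f a h n x = slope f a h n k.
Proof.
move=> h0 kn xk; rewrite /dyadic_slope (bigD1 (Ordinal kn))//= big1 ?addr0.
  by rewrite indicE mem_set ?mulr1// /cell/= in_itv.
move=> i /eqP ik; rewrite indicE memNset ?mulr0// /cell/= in_itv/= => xi.
by apply: ik; apply: val_inj => /=; exact: grid_uniq xi xk.
Qed.

Lemma measurable_dyadic_slope f a h n : measurable_fun [set: R] (dyadic_slope f a h n).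
Proof.
apply: measurable_sum => k; apply: measurable_funM => //.
by apply: measurable_indic; exact: measurable_cell.
Qed.

(** On each cell, slope times length is the increment of [f]. Together with [grid_variation_bounded]
    this bounds the dyadic slopes in L1 uniformly in the level. *)
Lemma integral_dyadic_slope f a h n : 0 < h ->
  (\int[mu]_x `|dyadic_slope f a h n x|%:E <=
   (\sum_(k < 2 ^ n) `|f (grid a h n k.+1) - f (grid a h n k)|)%:E)%E.
Proof.
move=> h0.
have mi k : measurable_fun [set: R] (fun x => `|slope f a h n k| * \1_(cell a h n k) x : R).
  by apply: measurable_funM => //; apply: measurable_indic; exact: measurable_cell.
apply: (@le_trans _ _ (\int[mu]_x (\sum_(k < 2 ^ n) (`|slope f a h n k| * \1_(cell a h n k) x)%:E)%E)%E).
  apply: ge0_le_integral => //.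
  - by apply/measurable_EFinP/measurableT_comp => //; exact: measurable_dyadic_slope.
  - by apply: emeasurable_sum => k; apply/measurable_EFinP; exact: mi.
  - move=> x _; rewrite sumEFin lee_fin; apply: le_trans (ler_norm_sum _ _ _) _.
    by apply: ler_sum => k _; rewrite normrM (ger0_norm (_ : 0 <= \1_ _ _)).
rewrite ge0_integral_sum//=; last by move=> k; apply/measurable_EFinP; exact: mi.
rewrite -sumEFin; apply: lee_sum => k _.
under eq_integral do rewrite EFinM.
rewrite ge0_integralZl//; last by apply/measurable_EFinP; apply: measurable_indic; exact: measurable_cell.
have -> : (\int[mu]_x (\1_(cell a h n k) x)%:E = (h / 2 ^+ n)%:E)%E.
  by rewrite integral_indic//; [rewrite setIT; exact: lebesgue_cell|exact: measurable_cell].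
rewrite -EFinM lee_fin /slope normrM normfV (gtr0_norm (mesh_gt0 n h0)).
by rewrite divfK// gt_eqF// mesh_gt0.
Qed.

Lemma measurable_limn_einf (u : (R -> R)^nat) : (forall n, measurable_fun [set: R] (u n)) ->
  measurable_fun [set: R] (fun x => limn_einf (fun n => (u n x)%:E)).
Proof.
move=> mu_; rewrite /limn_einf; apply: measurableT_comp => //.
apply: (@measurable_fun_limn_esup _ _ _ _ (fun n x => - (u n x)%:E)%E) => n.
suff : measurable_fun [set: R] (EFin \o (fun x => - u n x)) by [].
by apply/measurable_EFinP; exact: measurableT_comp.
Qed.

Lemma measurable_acc_point (u : (R -> R)^nat) : (forall n, measurable_fun [set: R] (u n)) ->
  measurable_fun [set: R] (fun x => acc_point (fun n => (u n x)%:E)).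
Proof.
move=> mu_; apply: measurable_maxe; first exact: measurable_limn_einf.
apply: measurable_mine => //.
apply: (@measurable_fun_limn_esup _ _ _ _ (fun n x => (u n x)%:E)%E) => n.
exact/measurable_EFinP.
Qed.

Lemma ac_on_near_grid a h f x : 0 < h -> ac_on a (a + h) f -> a < x <= a + h ->
  forall e, 0 < e -> exists n, exists2 k, (k < 2 ^ n)%N & `|f (grid a h n k.+1) - f x| < e.
Proof.
move=> h0 acf /andP[ax xb] e e0.
have [d d0 Hd] := ac_on_unif acf e0; have [n Hn] := mesh_small h0 d0.
have [|k] := @grid_cover R a h n 1 x ax; first by rewrite mul1r.
rewrite mul1n => kn /andP[xk xk1]; exists n, k => //.
have kb : grid a h n k.+1 <= a + h.
  by rewrite -[X in a + X]mul1r -(grid_last a h n 1) mul1n le_grid.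
apply: Hd => //; first exact: ltW.
apply: (@le_lt_trans _ _ (h / 2 ^+ n)); last exact: Hn.
by rewrite gridS lerBlDl lerD2r ltW.
Qed.

(** At almost every [x], infinitely many levels give [f] a slope of at least [g x - e / 2], while
    all fine levels give [G] a slope of at most [g x + e / 2]. A common level gives [f - G] a slope
    of at least [- e], as [ac_on_grid_le] requires. *)
Lemma ac_on_grid_ge_primitive f G g a h : 0 < h ->
  ac_on a (a + h) (fun x => f x - G x) ->
  {ae mu, forall x, a < x -> is_derive x 1 G (g x)} ->
  {ae mu, forall x, forall (e : R) n0, 0 < e ->
    exists2 n, (n0 <= n)%N & g x - e <= dyadic_slope f a h n x} ->
  forall m j, (j <= 2 ^ m)%N -> f a - G a <= f (grid a h m j) - G (grid a h m j).
Proof.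
move=> h0 acfG derG freq m j jm.
have jE : grid a h m j = a + j%:R * (h / 2 ^+ m) by [].
have jh : grid a h m j <= a + h.
  by rewrite -[X in a + X]mul1r -(grid_last a h m 1) mul1n le_grid.
rewrite jE; apply: (@ac_on_grid_le _ a (h / 2 ^+ m) j (fun x => f x - G x)).
- exact: mesh_gt0.
- by rewrite -jE; exact: ac_onS acfG.
apply: ae_imply2 derG freq => x Gx Sx /andP[ax xj] e e0.
have {}Gx := Gx ax.
have e2 : 0 < e / 2 by rewrite divr_gt0.
have [r r0 Hr] := is_derive_straddle Gx e2.
have [n1 Hn1] := mesh_small h0 r0.
(* Level at least [m], for the cell to be a dyadic part of a block of length [h / 2 ^ m]; level at
   least [n1], for the straddle estimate to apply. *)
have [n] := Sx (e / 2) (maxn m n1) e2.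
rewrite geq_max => /andP[mn n1n] Sn.
have [|k kn xk] := @grid_cover R a h n 1 x ax.
  by rewrite mul1r (le_trans _ jh)// jE.
rewrite mul1n in kn; rewrite (dyadic_slopeE f h0 kn xk) in Sn.
exists (n - m)%N, k.
have meshE : h / 2 ^+ m / 2 ^+ (n - m) = h / 2 ^+ n.
  by rewrite -mulrA -invfM -exprD subnKC.
rewrite !grid_level subnKC// meshE; split => //.
  rewrite -(@lt_grid _ a h n)//; case/andP : xk => xk _; apply: lt_le_trans xk _.
  by apply: le_trans xj _; rewrite -(grid_last a _ (n - m)) grid_level subnKC.
have := mesh_gt0 n h0; set d := h / 2 ^+ n => d0.
move: xk => /andP[xk1 xk2].
have := Hr _ _ (ltW xk1) xk2; rewrite [X in X - _]gridS [_ + _ - _]addrAC subrr add0r -/d => /(_ (Hn1 n n1n)).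
rewrite ler_norml => /andP[_ HG].
move: Sn; rewrite /slope -/d ler_pdivlMr// => Sn; lra.
Qed.

(* [g x] lies between the lower and the upper limit of the dyadic slopes of [f] around [x];
   it is integrable by Fatou's lemma, as [f] has bounded variation.  By Lebesgue's
   differentiation theorem the slopes of [int g] converge to [g] a.e., so both [f - int g]
   and [int g - f] satisfy the hypothesis of [ac_on_grid_le], whence [f - int g] is constant. *)
Theorem ac_on_primitive a b f : a < b -> ac_on a b f ->
  exists2 g, mu.-integrable [set: R] (EFin \o g) &
    forall x, a <= x <= b -> f x = f a + \int[mu]_(t in `[a, x]) g t.
Proof.
move=> ab acf; pose h := b - a; have h0 : 0 < h by rewrite subr_gt0.
have hb : a + h = b by rewrite /h addrC subrK.
have [M HM] : exists M, forall n, \sum_(k < 2 ^ n) `|f (grid a h n k.+1) - f (grid a h n k)| <= M.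
  by apply: grid_variation_bounded => //; rewrite hb.
pose S := dyadic_slope f a h.
have mS n : measurable_fun [set: R] (S n) by exact: measurable_dyadic_slope.
pose gE x := acc_point (fun n => (S n x)%:E).
have mgE : measurable_fun [set: R] gE by exact: measurable_acc_point.
have igE : mu.-integrable [set: R] gE.
  apply/integrableP; split => //.
  apply: (@le_lt_trans _ _ (\int[mu]_x limn_einf (fun n => `|(S n x)%:E|))%E).
    apply: ge0_le_integral => //.
    - exact: measurableT_comp.
    - by apply: measurable_limn_einf => n; exact: measurableT_comp.
    - by move=> x _; exact: abse_acc_point.
  apply: le_lt_trans (fatou _ measurableT _ _) _ => //.
    move=> n; suff : measurable_fun [set: R] (EFin \o (fun x => `|S n x|)) by [].
    by apply/measurable_EFinP; exact: measurableT_comp.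
  apply: (@le_lt_trans _ _ M%:E); last exact: ltry.
  apply: le_trans (limn_einf_sup _) _; apply: (@limn_esup_ub _ _ _ 0%N) => n _.
  by apply: le_trans (integral_dyadic_slope _ _ _ h0) _; rewrite lee_fin.
(* Infinite values of [gE] become 0; integrability confines them to a null set ([finG]). *)
pose g x := fine (gE x).
have ig : mu.-integrable [set: R] (EFin \o g).
  apply: le_integrable igE => //.
    by apply/measurable_EFinP; exact: measurableT_comp.
  by move=> x _ /=; rewrite /g; case: (gE x) => //=; rewrite normr0 leey.
exists g => //.
pose G x := \int[mu]_(t in `[a, x]) g t.
have acG : ac_on a b G by exact: ac_on_integral.
have derG : {ae mu, forall x, a < x -> is_derive x 1 G (g x)}.
  have loc : locally_integrable [set: R] g by by apply: open_integrable_locally => //; exact: openT.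
  have igI (A : set R) : measurable A -> mu.-integrable A (EFin \o g).
    by move=> mA; exact: integrableS ig.
  have := @FTC1 R g (BLeft a) (fun y => igI _ (measurable_itv _)) loc.
  apply: ae_imply => x Hx ax; have [d1 d2] := Hx ax.
  exact: derivable_is_derive.
have finG : {ae mu, forall x, gE x \is a fin_num}.
  by apply: ae_imply (integrable_ae measurableT igE) => x /(_ I).
have freq x : gE x \is a fin_num -> forall (e : R) n0, 0 < e ->
  (exists2 n, (n0 <= n)%N & g x - e <= S n x) /\ (exists2 n, (n0 <= n)%N & S n x <= g x + e).
  move=> gx e n0 e0; have gxE : gE x = (g x)%:E by rewrite /g fineK.
  split; apply: contrapT => H.
    have : (limn_esup (fun n => (S n x)%:E) <= (g x - e)%:E)%E.
      apply: (@limn_esup_ub _ _ _ n0) => n n0n; rewrite lee_fin leNgt; apply/negP => lt_.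
      by apply: H; exists n => //; exact: ltW.
    apply/negP; rewrite -ltNge; apply: lt_le_trans (acc_point_le _).
    by rewrite -/(gE x) gxE lte_fin gtrBl.
  have : ((g x + e)%:E <= limn_einf (fun n => (S n x)%:E))%E.
    apply: (@limn_einf_lb _ _ _ n0) => n n0n; rewrite lee_fin leNgt; apply/negP => lt_.
    by apply: H; exists n => //; exact: ltW.
  apply/negP; rewrite -ltNge; apply: le_lt_trans (acc_point_ge _) _.
  by rewrite -/(gE x) gxE lte_fin ltrDl.
have dyadicN n x : dyadic_slope (fun y => - f y) a h n x = - S n x.
  rewrite /S /dyadic_slope -sumrN; apply: eq_bigr => k _.
  by rewrite /slope -mulNr -mulNr; congr (_ / _ * _); rewrite opprB addrC opprK.
have gridE m j : (j <= 2 ^ m)%N -> f a - G a = f (grid a h m j) - G (grid a h m j).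
  move=> jm; apply/eqP; rewrite eq_le; apply/andP; split.
    apply: (@ac_on_grid_ge_primitive _ _ g) => //; first by rewrite hb; exact: ac_onB.
    by apply: ae_imply finG => x /freq H e n0 /(H e n0)[].
  rewrite -lerN2 !opprD.
  apply: (@ac_on_grid_ge_primitive (fun x => - f x) (fun x => - G x) (fun x => - g x)) => //.
  - rewrite hb; have := ac_onB (ac_onB acG acf) (ac_on_cst a b 0).
    by under eq_fun do rewrite subr0 addrC -[X in _ + X]opprK.
  - by apply: ae_imply derG => x H /H {}H; exact: is_deriveN.
  - apply: ae_imply finG => x /freq H e n0 /(H e n0)[_ [n n0n Sn]]; exists n => //.
    by rewrite dyadicN -opprD lerN2.
have Ga : G a = 0 by rewrite /G set_itv1 Rintegral_set1.
move=> x; rewrite le_eqVlt => /andP[/predU1P[<-|ax] xb]; first by rewrite -/(G a) Ga addr0.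
rewrite -/(G x); apply/eqP; rewrite -subr_eq -[X in _ == X]subr0 -Ga; apply/eqP.
apply/eqP; rewrite -subr_eq0 -normr_le0; apply/ler_addgt0Pl => e e0; rewrite addr0.
have acfG : ac_on a (a + h) (fun y => f y - G y) by rewrite hb; exact: ac_onB.
have axb : a < x <= a + h by rewrite ax hb.
(* The identity is known at grid points only; some grid point has its value of [f - G] within [e] of
   the value at [x]. *)
have [n [k kn fk]] := ac_on_near_grid h0 acfG axb e0.
by rewrite (gridE n k.+1 kn) distrC ltW.
Unshelve. all: by end_near. Qed.

End Primitive.

(** * Calculus of locally absolutely continuous functions *)

Section LocallyAC.
Variable R : realType.
Local Notation mu := (@lebesgue_measure R).
Implicit Types (a b c x y : R) (f g : R -> R).

Lemma is_derive_cvgP f x (d : R) :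
  is_derive x 1 f d <-> (fun h : R => h^-1 *: (f (h *: 1 + x) - f x)) @ 0^' --> d.
Proof.
split=> [Df|cf]; first by have <- := @derive_val _ _ _ _ _ _ _ Df; exact: ex_derive.
split; first by apply/cvg_ex; exists d.
exact: cvg_lim cf.
Qed.

Lemma is_derive_near_eq f g x (d : R) : f x = g x -> (\forall y \near x, f y = g y) ->
  is_derive x 1 f d -> is_derive x 1 g d.
Proof.
move=> fgx /nbhs_ballP[r /= r0 fg] /is_derive_cvgP cf; apply/is_derive_cvgP.
apply: cvg_trans cf; apply: near_eq_cvg; near=> h; rewrite fgx fg//.
rewrite /ball/= opprD addrCA subrr addr0 normrN [h *: _]mulr1.
by near: h; apply: dnbhs0_lt.
Unshelve. all: by end_near. Qed.

Lemma Rintegral_ae_le0 f a b : mu.-integrable `[a, b] (EFin \o f) ->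
  {ae mu, forall x, a < x < b -> f x <= 0} -> a <= b -> \int[mu]_(t in `[a, b]) f t <= 0.
Proof.
move=> fi f0 ab.
have fio : mu.-integrable `]a, b[ (EFin \o f).
  by apply: integrableS fi => // x /=; rewrite !in_itv/= => /andP[/ltW -> /ltW].
have fic : mu.-integrable `]a, b] (EFin \o f).
  by apply: integrableS fi => // x /=; rewrite !in_itv/= => /andP[/ltW ->].
rewrite -Rintegral_itv_obnd_cbnd// -Rintegral_itv_bndo_bndc//.
(* [f] agrees with this function almost everywhere on the open interval, and the latter is
   nonpositive everywhere, so monotonicity of the integral applies. *)
pose h x := Num.min (f x) 0.
have mf : measurable_fun `]a, b[ f by apply/measurable_EFinP; exact: measurable_int fio.
rewrite (_ : \int[mu]_(t in _) _ = \int[mu]_(t in `]a, b[) h t).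
  have ih : mu.-integrable `]a, b[ (EFin \o h).
    apply: le_integrable fio => //.
      by apply/measurable_EFinP; exact: measurable_minr.
    move=> x _; rewrite lee_fin /h /=; have [f0x|f0x] := leP (f x) 0; first by rewrite lexx.
    by rewrite normr0.
  rewrite (le_trans (@le_Rintegral _ _ _ mu _ h (cst 0) _ ih _ _))//.
  - by apply: eq_integrable (integrable0 mu _) => //.
  - by move=> x _; rewrite /h ge_min lexx orbT.
  - by rewrite Rintegral_cst// mul0r.
congr fine; apply: ae_eq_integral => //.
- exact/measurable_EFinP.
- by apply/measurable_EFinP; apply: measurable_minr.
- apply: ae_imply f0 => x f0 /=; rewrite in_itv/= => /f0 fx0.
  by rewrite /h min_l.
Qed.

(* The first conclusion makes the hypothesis of the second one meaningful. *)
Lemma ac_on_derive f a b : a < b -> ac_on a b f ->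
  {ae mu, forall x, a < x < b -> derivable f x 1} /\
  ({ae mu, forall x, a < x < b -> forall d, is_derive x 1 f d -> d <= 0} -> f b <= f a).
Proof.
move=> ab acf; have [g ig fg] := ac_on_primitive ab acf.
have igI (A : set R) : measurable A -> mu.-integrable A (EFin \o g).
  by move=> mA; exact: integrableS ig.
have dG : {ae mu, forall x, a < x < b -> is_derive x 1 f (g x)}.
  have loc : locally_integrable [set: R] g.
    by apply: open_integrable_locally => //; exact: openT.
  have := @FTC1 R g (BLeft a) (fun y => igI _ (measurable_itv _)) loc.
  apply: ae_imply => x Hx /andP[ax xb]; have [d1 d2] := Hx ax.
  have Gx : is_derive x 1 (cst (f a) + (fun x => \int[mu]_(t in `[a, x]) g t)) (g x).
    by rewrite -[X in is_derive _ _ _ X]add0r; apply: is_deriveD; exact: derivable_is_derive.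
  apply: is_derive_near_eq Gx; first by apply/esym/fg; rewrite (ltW ax) (ltW xb).
  have : x \in `]a, b[ by rewrite in_itv/= ax.
  move=> /near_in_itvoo; apply: filterS => y; rewrite in_itv/= => /andP[ay yb].
  by apply/esym/fg; rewrite (ltW ay) (ltW yb).
split; first by apply: ae_imply dG => x H /H [].
move=> df; have := fg b; rewrite lexx ltW// => /(_ isT) ->.
rewrite gerDl; apply: Rintegral_ae_le0 (ltW ab); first by apply: igI; exact: measurable_itv.
by apply: ae_imply2 dG df => x H1 H2 xab; apply: H2 xab _ (H1 xab).
Qed.

End LocallyAC.

Section Locac.
Variable R : realType.
Local Notation mu := (@lebesgue_measure R).
Implicit Types (a b c x y : R) (f g : R -> R).

Definition locac f := forall a b, a <= b -> ac_on a b f.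

Lemma is_derive_uniq f x (d d' : R) : is_derive x 1 f d -> is_derive x 1 f d' -> d = d'.
Proof. by move=> [_ <-] [_ <-]. Qed.

Lemma locac_derivable f : locac f -> {ae mu, forall x, derivable f x 1}.
Proof.
move=> acf.
have H n : {ae mu, forall x, - n.+1%:R < x < n.+1%:R -> derivable f x 1}.
  have n0 : - n.+1%:R < n.+1%:R :> R by rewrite (@lt_trans _ _ 0)// ?oppr_lt0 ltr0n.
  by have [] := ac_on_derive n0 (acf _ _ (ltW n0)).
have := ae_foralln H; apply: ae_imply => x /(_ (Num.bound `|x|)); apply.
rewrite -ltr_norml; apply: lt_trans (archi_boundP (normr_ge0 x)) _.
by rewrite ltr_nat.
Qed.

Lemma locac_le f a b : locac f -> a <= b ->
  {ae mu, forall x, a < x < b -> forall d, is_derive x 1 f d -> d <= 0} -> f b <= f a.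
Proof.
move=> acf; rewrite le_eqVlt => /predU1P[->//|ab].
by have [_] := ac_on_derive ab (acf _ _ (ltW ab)).
Qed.

(** Common source of the closure properties below: sums, opposites, products and exponentials all
    have increments controlled, on bounded intervals, by those of their arguments. *)
Lemma locac_dom f g1 g2 : locac g1 -> locac g2 ->
  (forall a b, exists K, forall x y, a <= x <= b -> a <= y <= b ->
    `|f y - f x| <= K * (`|g1 y - g1 x| + `|g2 y - g2 x|)) -> locac f.
Proof.
move=> ac1 ac2 dom a b ab e e0; have [K HK] := dom a b.
pose L := `|K| + 1; have L0 : 0 < L by rewrite ltr_wpDl.
have e2 : 0 < e / L / 2 by rewrite !divr_gt0.
have [d1 d10 H1] := ac1 a b ab _ e2; have [d2 d20 H2] := ac2 a b ab _ e2.
exists (Num.min d1 d2); first by rewrite lt_min d10.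
move=> n s t st ts; rewrite lt_min => /andP[sd1 sd2].
have := ltrD (H1 n s t st ts sd1) (H2 n s t st ts sd2).
rewrite -splitr -big_split/= ltr_pdivlMr// mulrC mulr_sumr.
apply: le_lt_trans; apply: ler_sum => k _.
have [sa [sk tb]] := st k (ltn_ord k).
apply: le_trans (HK (s k) (t k) _ _) _; [by rewrite sa (le_trans sk)|by rewrite tb (le_trans sa)|].
by rewrite ler_wpM2r ?addr_ge0// (le_trans (ler_norm K))// lerDl.
Qed.

Lemma locac_cst c : locac (fun=> c).
Proof. by move=> a b _; exact: ac_on_cst. Qed.

Lemma locacD f g : locac f -> locac g -> locac (fun x => f x + g x).
Proof.
move=> acf acg; apply: (locac_dom acf acg) => a b; exists 1 => x y _ _.
by rewrite mul1r opprD addrACA ler_normD.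
Qed.

Lemma locacN f : locac f -> locac (fun x => - f x).
Proof.
move=> acf; apply: (locac_dom acf (locac_cst 0)) => a b; exists 1 => x y _ _.
by rewrite mul1r -opprD normrN lerDl.
Qed.

Lemma locacB f g : locac f -> locac g -> locac (fun x => f x - g x).
Proof. by move=> acf acg; apply: locacD acf (locacN acg). Qed.

Lemma locac_continuous f : locac f -> continuous f.
Proof.
move=> acf x; apply/cvgrPdist_lt => e e0.
have [|d d0 Hd] := ac_on_unif (acf (x - 1) (x + 1) _) e0; first by lra.
have m0 : 0 < Num.min 1 d by rewrite lt_min ltr01.
apply/nbhs_ballP; exists (Num.min 1 d) => // y /=.
rewrite /ball/= lt_min ltr_norml => /andP[/andP[y1 y2]]; rewrite ltr_norml => /andP[y3 y4].
have [xy|yx] := leP x y; first by rewrite distrC Hd//; lra.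
by rewrite Hd//; lra.
Qed.

Lemma locac_measurable f : locac f -> measurable_fun [set: R] f.
Proof. by move=> /locac_continuous; exact: continuous_measurable_fun. Qed.

Lemma locac_bounded f a b : locac f -> exists M, forall x, a <= x <= b -> `|f x| <= M.
Proof.
move=> acf; have [ab|ba] := leP a b; last first.
  by exists 0 => x /andP[ax xb]; have := lt_le_trans ba (le_trans ax xb); rewrite ltxx.
have cf : {within `[a, b], continuous (fun x => `|f x|)}.
  apply: continuous_subspaceT => x; apply: cvg_norm; exact: locac_continuous.
have [c _ Hc] := EVT_max ab cf.
by exists `|f c| => x xab; apply: Hc; rewrite in_itv.
Qed.

Lemma locacM f g : locac f -> locac g -> locac (fun x => f x * g x).
Proof.
move=> acf acg; apply: (locac_dom acf acg) => a b.
have [M HM] := locac_bounded a b acf; have [N HN] := locac_bounded a b acg.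
exists (`|M| + `|N|) => x y xab yab.
rewrite (_ : _ - _ = f y * (g y - g x) + g x * (f y - f x)); last by ring.
apply: le_trans (ler_normD _ _) _; rewrite !normrM mulrDr addrC; apply: lerD.
  rewrite ler_wpM2r// (le_trans (HN x xab))// (le_trans (ler_norm N))// lerDr.
  exact: normr_ge0.
by rewrite ler_wpM2r// (le_trans (HM y yab))// (le_trans (ler_norm M))// lerDl.
Qed.

Lemma locac_sum (I : finType) (F : I -> R -> R) :
  (forall i, locac (F i)) -> locac (fun x => \sum_i F i x).
Proof.
move=> acF; elim: (index_enum I) => [|i s IH].
  by under eq_fun do rewrite big_nil; exact: locac_cst.
by under eq_fun do rewrite big_cons; exact: locacD (acF i) IH.
Qed.

Lemma expR_lip M x y : x <= M -> y <= M -> `|expR y - expR x| <= expR M * `|y - x|.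
Proof.
wlog xy : x y / x <= y => [H xM yM|].
  have [xy|yx] := leP x y; first exact: H.
  by rewrite distrC [in leRHS]distrC; apply: H => //; exact: ltW.
move=> xM yM; rewrite !ger0_norm ?subr_ge0 ?ler_expR//.
apply: (@le_trans _ _ (expR y * (y - x))); last by rewrite ler_wpM2r ?subr_ge0// ler_expR.
(* The tangent bound [1 + t <= exp t] at [t = x - y], multiplied by [exp y]. *)
have := expR_ge1Dx (x - y); rewrite -(ler_pM2l (expR_gt0 y)) -expRD (addrC y) subrK.
by set e := expR x; set e' := expR y; lra.
Qed.

Lemma locac_expR f : locac f -> locac (fun x => expR (f x)).
Proof.
move=> acf; apply: (locac_dom acf (locac_cst 0)) => a b.
have [M HM] := locac_bounded a b acf.
exists (expR M) => x y xab yab; rewrite subrr normr0 addr0.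
by apply: expR_lip; exact: le_trans (ler_norm _) (HM _ _).
Qed.

Lemma locac_eq0 f : locac f -> {ae mu, forall x, forall d, is_derive x 1 f d -> d = 0} ->
  forall x y, f x = f y.
Proof.
move=> acf df; suff H x y : x <= y -> f x = f y.
  by move=> x y; have [/H//|/ltW/H] := leP x y.
move=> xy; apply/eqP; rewrite eq_le; apply/andP; split; last first.
  by apply: locac_le => //; apply: ae_imply df => z Hz _ d /Hz ->.
rewrite -lerN2; apply: (locac_le (locacN acf)) => //; apply: ae_imply df => z Hz _ d Hd.
have Hd' : is_derive z 1 f (- d).
  by have := @is_deriveN _ _ _ _ _ _ _ Hd; congr (is_derive _ _ _ _); apply/funext => u; rewrite opprfctE opprK.
by rewrite -[d]opprK (Hz _ Hd') oppr0.
Qed.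

End Locac.

(** * Primitives of locally integrable functions *)

Section Locint.
Variable R : realType.
Local Notation mu := (@lebesgue_measure R).
Implicit Types (a b c x y : R) (f g : R -> R).

Definition locint f :=
  measurable_fun [set: R] f /\ forall a b, mu.-integrable `[a, b] (EFin \o f).

Lemma locally_integrable_locint f : locally_integrable [set: R] f -> locint f.
Proof.
move=> [mf _ intf]; split => // a b; apply/integrableP; split.
  by apply/measurable_EFinP; exact: measurable_funTS.
by apply: intf => //; exact: segment_compact.
Qed.

Lemma locint_locally_integrable f : locint f -> locally_integrable [set: R] f.
Proof.
move=> [mf intf]; split => //; first exact: openT.
move=> K _ cK; have [M [_ HM]] := compact_bounded cK.
have KM : K `<=` `[- (`|M| + 1), `|M| + 1].
  move=> x Kx; rewrite /= in_itv/= -ler_norml; apply: HM => //.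
  by rewrite (le_lt_trans (ler_norm M))// ltrDl.
have /integrableP[_] := intf (- (`|M| + 1)) (`|M| + 1).
apply: le_lt_trans; apply: ge0_subset_integral => //.
- exact: compact_measurable.
- by apply/measurable_EFinP; apply/measurableT_comp => //; exact: measurable_funTS.
Qed.

Lemma locint_norm f : locint f -> locint (fun x => `|f x|).
Proof.
move=> [mf intf]; split; first exact: measurableT_comp.
by move=> a b; exact: integrable_abse (intf a b).
Qed.

Lemma locintD f g : locint f -> locint g -> locint (fun x => f x + g x).
Proof.
move=> [mf intf] [mg intg]; split; first exact: measurable_funD.
by move=> a b; apply: (@integrableD _ _ _ mu _ _ (EFin \o f) (EFin \o g)).
Qed.

Lemma locintN f : locint f -> locint (fun x => - f x).
Proof.
move=> [mf intf]; split; first exact: measurableT_comp.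
by move=> a b; exact: (integrableN (intf a b)).
Qed.

Lemma locintM f g : locint f -> measurable_fun [set: R] g ->
  (forall a b, exists M, forall x, a <= x <= b -> `|g x| <= M) -> locint (fun x => f x * g x).
Proof.
move=> [mf intf] mg bg; split; first exact: measurable_funM.
move=> a b; apply: integrableMl (intf a b) _ _ => //.
  exact: measurable_funTS.
have [M HM] := bg a b; exists M; split; first exact: num_real.
by move=> N MN x /=; rewrite in_itv/= => /HM /le_trans; apply; exact: ltW.
Qed.

Lemma locint_cst c : locint (fun=> c).
Proof.
split=> // a b; apply: continuous_compact_integrable; first exact: segment_compact.
by move=> x; exact: cvg_cst.
Qed.

Lemma locint_sum (I : finType) (F : I -> R -> R) :
  (forall i, locint (F i)) -> locint (fun x => \sum_i F i x).
Proof.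
move=> iF; elim: (index_enum I) => [|i s IH].
  by under eq_fun do rewrite big_nil; exact: locint_cst.
by under eq_fun do rewrite big_cons; exact: locintD (iF i) IH.
Qed.

Lemma locintM_locac f g : locint f -> locac g -> locint (fun x => f x * g x).
Proof.
move=> intf acg; apply: locintM intf (locac_measurable acg) _ => a b.
exact: locac_bounded.
Qed.

Lemma Rintegral_itvD f a b c : locint f -> a <= b -> b <= c ->
  \int[mu]_(t in `[a, c]) f t = \int[mu]_(t in `[a, b]) f t + \int[mu]_(t in `[b, c]) f t.
Proof.
move=> [_ intf] ab bc; apply/eqP; rewrite addrC -subr_eq; apply/eqP.
rewrite Rintegral_itvB; [|exact: intf|by rewrite bnd_simp|by rewrite bnd_simp].
rewrite Rintegral_itv_obnd_cbnd//; apply: integrableS (intf b c) => //.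
by move=> x /=; rewrite !in_itv/= => /andP[/ltW -> ->].
Qed.

(* At least one of the two integrals vanishes: this is the oriented integral from 0 to [x]. *)
Definition primitive f x := \int[mu]_(t in `[0, x]) f t - \int[mu]_(t in `[x, 0]) f t.

Lemma primitive0 f : primitive f 0 = 0.
Proof. by rewrite /primitive subrr. Qed.

(** A base point to the left of both 0 and [x] removes the case distinction on the sign of [x] and
    gives the form with a fixed left end to which the differentiation theorem applies. *)
Lemma primitiveE f c x : locint f -> c <= 0 -> c <= x ->
  primitive f x = \int[mu]_(t in `[c, x]) f t - \int[mu]_(t in `[c, 0]) f t.
Proof.
move=> intf c0 cx; rewrite /primitive; have [x0|x0] := leP 0 x.
  rewrite (Rintegral_itvD intf c0 x0) [in RHS]addrAC subrr add0r.
  move: x0; rewrite le_eqVlt => /predU1P[<-|x0]; first by rewrite set_itv1 Rintegral_set1 subr0.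
  by rewrite [X in _ - X](_ : _ = 0) ?subr0// set_itv_ge ?Rintegral_set0// bnd_simp -ltNge.
rewrite (Rintegral_itvD intf cx (ltW x0)) opprD addrA subrr add0r.
by rewrite set_itv_ge ?Rintegral_set0 ?add0r// bnd_simp -ltNge.
Qed.

Lemma primitiveB f x y : locint f -> x <= y ->
  primitive f y - primitive f x = \int[mu]_(t in `[x, y]) f t.
Proof.
move=> intf xy; pose c := Num.min x 0.
have cx : c <= x by rewrite /c ge_min lexx.
have c0 : c <= 0 by rewrite /c ge_min lexx orbT.
rewrite (primitiveE intf c0 cx) (primitiveE intf c0 (le_trans cx xy)).
by rewrite (Rintegral_itvD intf cx xy) opprB addrA subrK addrAC subrr add0r.
Qed.

Lemma locac_primitive f : locint f -> locac (primitive f).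
Proof.
move=> intf a b ab; pose c := Num.min a 0.
have ca : c <= a by rewrite /c ge_min lexx.
have c0 : c <= 0 by rewrite /c ge_min lexx orbT.
(* [ac_on_integral] asks for integrability on the whole line; truncation to [[c, b]] provides it
   without changing the integrals involved. *)
pose g := f \_ `[c, b].
have ig : mu.-integrable [set: R] (EFin \o g).
  by have := intf.2 c b; rewrite integrable_mkcond//= (restrict_EFin f).
have acG : ac_on a b (fun x => \int[mu]_(t in `[c, x]) g t) by exact: ac_on_integral.
move=> e /acG[d d0 H]; exists d => // n s t st ts sd.
have primg x : a <= x <= b -> primitive f x = \int[mu]_(t in `[c, x]) g t - \int[mu]_(t in `[c, 0]) f t.
  move=> /andP[ax xb]; rewrite (primitiveE intf c0 (le_trans ca ax)); congr (_ - _).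
  apply: eq_Rintegral => y; rewrite inE/= in_itv/= => /andP[cy yx].
  by rewrite /g patchE mem_set//= in_itv/= cy (le_trans yx).
have := H n s t st ts sd; congr (_ < _); apply: eq_bigr => k _.
have [sa [sk tb]] := st k (ltn_ord k).
rewrite !primg ?sa ?tb ?(le_trans sa)// ?(le_trans sk)//.
by rewrite opprB addrA subrK.
Qed.

Lemma is_derive_primitive f : locint f -> {ae mu, forall x, is_derive x 1 (primitive f) (f x)}.
Proof.
move=> intf; have loc := locint_locally_integrable intf.
(* Each base point [- (n + 1)] handles all [x] to its right; countably many of them cover the
   line. *)
have H n : {ae mu, forall x, - n.+1%:R < x -> is_derive x 1 (primitive f) (f x)}.
  set c : R := - n.+1%:R.
  have c0 : c <= 0 by rewrite oppr_le0.
  have := @FTC1 R f (BLeft c) (fun y => intf.2 _ _) loc.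
  apply: ae_imply => x Hx cx; have [d1 d2] := Hx cx.
  have Gx : is_derive x 1 ((fun y => \int[mu]_(t in `[c, y]) f t) - cst (\int[mu]_(t in `[c, 0]) f t)) (f x).
    by rewrite -[X in is_derive _ _ _ X]subr0; apply: is_deriveB; exact: derivable_is_derive.
  apply: is_derive_near_eq Gx; first by rewrite (primitiveE intf c0 (ltW cx)).
  have : x \in `]c, +oo[ by rewrite in_itv/= cx.
  move=> /near_in_itvoy; apply: filterS => y; rewrite in_itv/= andbT => cy.
  by rewrite (primitiveE intf c0 (ltW cy)).
have := ae_foralln H; apply: ae_imply => x /(_ (Num.bound `|x|)); apply.
rewrite ltrNl; apply: le_lt_trans (ler_norm _) _; rewrite normrN.
apply: lt_trans (archi_boundP (normr_ge0 x)) _.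
by rewrite ltr_nat.
Qed.

(** For [x < 0] the oriented integral of [h] is nonpositive, whence the absolute value on the
    right. *)
Lemma le_primitiveB f g h x : locint f -> locint g -> locint h ->
  (forall t, `|f t - g t| <= h t) -> `|primitive f x - primitive g x| <= `|primitive h x|.
Proof.
move=> intf intg inth fgh.
have key a b : `|\int[mu]_(t in `[a, b]) f t - \int[mu]_(t in `[a, b]) g t| <=
    `|\int[mu]_(t in `[a, b]) h t|.
  rewrite -RintegralB//; [|exact: intf.2|exact: intg.2].
  have intfg := locintD intf (locintN intg).
  apply: le_trans (le_normr_Rintegral _ (intfg.2 a b)) _ => //.
  apply: le_trans (ler_norm _); apply: le_Rintegral => //.
  - exact: (locint_norm intfg).2.
  - exact: inth.2.
have [x0|/ltW x0] := leP 0 x.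
  have := primitiveB intf x0; have := primitiveB intg x0; have := primitiveB inth x0.
  by rewrite !primitive0 !subr0 => -> -> ->.
have := primitiveB intf x0; have := primitiveB intg x0; have := primitiveB inth x0.
rewrite !primitive0 !sub0r => eh eg ef.
rewrite -[primitive f x]opprK ef -[primitive g x]opprK eg -opprD normrN.
by rewrite -[primitive h x]opprK eh normrN.
Qed.

Lemma primitive_cvg (F : nat -> R -> R) f h x : (forall n, locint (F n)) -> locint f -> locint h ->
  (forall t, F ^~ t @ \oo --> f t) -> (forall n t, `|F n t| <= h t) ->
  (fun n => primitive (F n) x) @ \oo --> primitive f x.
Proof.
move=> intF intf inth Ff Fh.
have key a b : (fun n => \int[mu]_(t in `[a, b]) F n t) @ \oo --> \int[mu]_(t in `[a, b]) f t.
  have mF n : measurable_fun `[a, b] (EFin \o F n) by exact: measurable_int ((intF n).2 a b).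
  have mf : measurable_fun `[a, b] (EFin \o f) by exact: measurable_int (intf.2 a b).
  have cF : {ae mu, forall t, [set` `[a, b]] t -> (EFin \o F n) t @[n --> \oo] --> (EFin \o f) t}.
    by apply: aeW => t _; apply: cvg_EFin; [exact: nearW|exact: Ff].
  have dF : {ae mu, forall t n, [set` `[a, b]] t -> (`|(EFin \o F n) t| <= (EFin \o h) t)%E}.
    by apply: aeW => t n _; rewrite lee_fin.
  have mI : measurable [set` `[a, b]] by exact: measurable_itv.
  have [_ _] := @dominated_convergence _ _ _ mu _ mI _ _ _ mF mf cF (inth.2 a b) dF.
  move=> cvF; apply: fine_cvg; rewrite /Rintegral fineK//.
  exact: integrable_fin_num (intf.2 a b).
exact: cvgB.
Qed.

End Locint.

(** * Linear systems with locally integrable coefficients *)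

Section DeriveFun.
Variable R : realType.
Local Notation mu := (@lebesgue_measure R).
Implicit Types (f g : R -> R) (x df dg : R).

Lemma is_derive_add f g x df dg : is_derive x 1 f df -> is_derive x 1 g dg ->
  is_derive x 1 (fun t => f t + g t) (df + dg).
Proof. by move=> Df Dg; exact: is_deriveD. Qed.

Lemma is_derive_opp f x df : is_derive x 1 f df -> is_derive x 1 (fun t => - f t) (- df).
Proof. by move=> Df; exact: is_deriveN. Qed.

Lemma is_derive_mul f g x df dg : is_derive x 1 f df -> is_derive x 1 g dg ->
  is_derive x 1 (fun t => f t * g t) (f x * dg + g x * df).
Proof. by move=> Df Dg; exact: is_deriveM. Qed.

Lemma is_derive_scale f (k : R) x df : is_derive x 1 f df ->
  is_derive x 1 (fun t => k * f t) (k * df).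
Proof. by move=> Df; exact: is_deriveZ. Qed.

Lemma is_derive_exp f x df : is_derive x 1 f df ->
  is_derive x 1 (fun t => expR (f t)) (expR (f x) * df).
Proof. by move=> Df; exact: is_derive1_comp. Qed.

Lemma is_derive_bigsum (I : finType) (F : I -> R -> R) (dF : I -> R) x :
  (forall i, is_derive x 1 (F i) (dF i)) ->
  is_derive x 1 (fun t => \sum_i F i t) (\sum_i dF i).
Proof.
move=> DF; elim: (index_enum I) => [|i s IH].
  by under eq_fun do rewrite big_nil; rewrite big_nil; exact: is_derive_cst.
by under eq_fun do rewrite big_cons; rewrite big_cons; exact: is_derive_add.
Qed.

Lemma ae_forall_fin (I : finType) (P : I -> R -> Prop) :
  (forall i, {ae mu, forall x, P i x}) -> {ae mu, forall x, forall i, P i x}.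
Proof.
move=> aeP.
have H n : {ae mu, forall x, forall i, pickle i = n -> P i x}.
  case E : (@unpickle I n) => [i|]; last first.
    by apply: aeW => x i ni; rewrite -ni pickleK in E.
  by apply: ae_imply (aeP i) => x Pi j nj; move: E; rewrite -nj pickleK => -[->].
by apply: ae_imply (ae_foralln H) => x Hx i; exact: Hx (pickle i) i erefl.
Qed.

End DeriveFun.

(** * Uniqueness and existence for real linear systems *)

Section LinearODE.
Variables (R : realType) (I : finType) (A : I -> I -> R -> R).
Local Notation mu := (@lebesgue_measure R).
Hypothesis intA : forall i j, locint (A i j).
Implicit Types (y : I -> R -> R) (x : R).

Definition linear_solution y := (forall i, locac (y i)) /\
  {ae mu, forall x, forall i, is_derive x 1 (y i) (\sum_j A i j x * y j x)}.

(** A scalar function dominating the matrix in the maximum norm ([row_le]); its primitive [m]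
    supplies the exponents in both the uniqueness and the existence estimates. *)
Let a x := \sum_i \sum_j `|A i j x|.

Let inta : locint a.
Proof. by do 2 apply: locint_sum => ?; exact: locint_norm. Qed.

Let a_ge0 x : 0 <= a x.
Proof. by rewrite sumr_ge0// => i _; rewrite sumr_ge0. Qed.

Let m := primitive a.

Let acm : locac m.
Proof. exact: locac_primitive. Qed.

Let dm : {ae mu, forall x, is_derive x 1 m (a x)}.
Proof. exact: is_derive_primitive. Qed.

Let row_le (i : I) x (z : I -> R) (M : R) : (forall j, `|z j| <= M) ->
  `|\sum_j A i j x * z j| <= a x * M.
Proof.
move=> zM; apply: le_trans (ler_norm_sum _ _ _) _.
apply: (@le_trans _ _ ((\sum_j `|A i j x|) * M)).
  by rewrite mulr_suml; apply: ler_sum => j _; rewrite normrM ler_wpM2l.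
rewrite ler_wpM2r ?(le_trans _ (zM i))//.
by rewrite /a [leRHS](bigD1 i)//= lerDl sumr_ge0// => k _; rewrite sumr_ge0.
Qed.

(* With [v = \sum_i (y i)^2] one has [|v'| <= 2 a v], so both [v exp(-2m)] and
   [- v exp(2m)] are nonincreasing, where [m' = a]. *)
Lemma linear_solution_eq0 y x0 : linear_solution y -> (forall i, y i x0 = 0) ->
  forall i x, y i x = 0.
Proof.
move=> [acy dy] y0.
pose v x := \sum_i y i x * y i x.
have acv : locac v by apply: locac_sum => i; exact: locacM.
have v_ge x i : y i x * y i x <= v x.
  by rewrite /v (bigD1 i)//= lerDl sumr_ge0// => j _; exact: sqr_ge0.
have v_ge0 x : 0 <= v x by rewrite sumr_ge0// => i _; exact: sqr_ge0.
have v0 : v x0 = 0 by rewrite /v big1// => i _; rewrite y0 mul0r.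
(* The sign [s = 1] makes [v] vanish to the right of [x0], and [s = -1] to the left. *)
pose w (s : R) x := (s * v x) * expR (s * (- 2 * m x)).
have acw s : locac (w s).
  have acs (k : R) f : locac f -> locac (fun x => k * f x).
    by move=> acf; apply: locacM => //; exact: locac_cst.
  by apply: locacM; [exact: acs|apply: locac_expR; do 2 apply: (acs)].
have w_le s b c : `|s| = 1 -> b <= c -> w s c <= w s b.
  move=> s1 bc; apply: locac_le => //; apply: ae_imply2 dm dy => x Dm Dy _ d Dw.
  pose dv := \sum_i (y i x * (\sum_j A i j x * y j x) + y i x * (\sum_j A i j x * y j x)).
  have Dv : is_derive x 1 v dv by apply: is_derive_bigsum => i; exact: is_derive_mul.
  have := is_derive_mul (is_derive_scale s Dv)
    (is_derive_exp (is_derive_scale s (is_derive_scale (- 2) Dm))).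
  move=> /(is_derive_uniq Dw) ->.
  have sdv : s * dv <= 2 * a x * v x.
    apply: le_trans (ler_norm _) _; rewrite normrM s1 mul1r.
    rewrite /dv (le_trans (ler_norm_sum _ _ _))// -mulrA mulr_suml mulr_sumr.
    apply: ler_sum => i _; rewrite mulr_suml -mulr2n normrMn -[leLHS]mulr_natl ler_pM2l//.
    rewrite mulr_sumr (le_trans (ler_norm_sum _ _ _))//; apply: ler_sum => j _.
    rewrite mulrCA normrM ler_wpM2l//.
    (* Uses [2 |p q| <= p ^ 2 + q ^ 2 <= 2 v]. *)
    have := v_ge x i; have := v_ge x j; rewrite ler_norml; set p := y i x; set q := y j x.
    by have := sqr_ge0 (p + q); have := sqr_ge0 (p - q); rewrite !expr2; nra.
  have ss : s * s = 1 by rewrite -expr2 -real_normK ?num_real// s1 expr1n.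
  set e := expR _.
  have e0 : 0 < e by exact: expR_gt0.
  rewrite (_ : _ + _ = e * (s * dv - (s * s) * (2 * a x * v x))); last by ring.
  by rewrite pmulr_rle0// ss mul1r subr_le0.
move=> i x; suff vx : v x = 0.
  by have := v_ge x i; rewrite vx -expr2 => h; apply/eqP; rewrite -sqrf_eq0 eq_le h sqr_ge0.
apply/eqP; rewrite eq_le v_ge0 andbT.
have [xx0|xx0] := leP x0 x.
  have := w_le 1 _ _ (normr1 _) xx0; rewrite /w v0 mulr0 mul0r mul1r.
  by rewrite pmulr_lle0// expR_gt0.
have := w_le (- 1) _ _ _ (ltW xx0); rewrite normrN normr1 => /(_ erefl).
by rewrite /w v0 mulr0 mul0r [-1 * v x]mulN1r [- v x * _]mulNr oppr_ge0 pmulr_lle0// expR_gt0.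
Qed.

(** Starting from 0 makes the first increment the initial value itself, so the geometric bound on
    increments holds from [n = 0] on. *)
Fixpoint picard (e : I -> R) n (i : I) : R -> R :=
  if n is n'.+1 then
    fun x => e i + primitive (fun t => \sum_j A i j t * picard e n' j t) x
  else fun=> 0.

Lemma picardS e n i x :
  picard e n.+1 i x = e i + primitive (fun t => \sum_j A i j t * picard e n j t) x.
Proof. by []. Qed.

Lemma locac_picard e n i : locac (picard e n i).
Proof.
elim: n i => [|n IH] i; first exact: locac_cst.
apply: locacD; first exact: locac_cst.
by apply: locac_primitive; apply: locint_sum => j; exact: locintM_locac.
Qed.

(** This is [2 cosh (2 m)]. Since [m] is nonpositive to the left of 0, a single exponential would
    decay there; the sum of both is even in [m], and [a C] has the explicit primitive
    [sinh (2 m)]. *)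
Let C x := expR (2 * m x) + expR (- (2 * m x)).

Let acC : locac C.
Proof.
have ac2 : locac (fun x => 2 * m x) by apply: locacM => //; exact: locac_cst.
by apply: locacD; apply: locac_expR => //; exact: locacN.
Qed.

Let C_ge1 x : 1 <= C x.
Proof.
have := expR_ge1Dx (2 * m x); have := expR_ge1Dx (- (2 * m x)).
by rewrite /C; set p := expR _; set q := expR _; lra.
Qed.

(* [C] dominates its own integral against [a]: this gains a factor 1/2 at each Picard step. *)
Let primitive_aC (k : R) x : 0 <= k -> `|primitive (fun t => a t * (k * C t)) x| <= k / 2 * C x.
Proof.
move=> k0.
have intaC : locint (fun t => a t * (k * C t)).
  by apply: locintM_locac => //; apply: locacM => //; exact: locac_cst.
pose S x := k / 2 * (expR (2 * m x) - expR (- (2 * m x))).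
have ac2 : locac (fun x => 2 * m x) by apply: locacM => //; exact: locac_cst.
have acS : locac S.
  apply: locacM; first exact: locac_cst.
  by apply: locacB; apply: locac_expR => //; exact: locacN.
have m0 : m 0 = 0 by exact: primitive0.
have -> : primitive (fun t => a t * (k * C t)) x = S x.
  apply/eqP; rewrite -subr_eq0; apply/eqP.
  rewrite (@locac_eq0 _ (fun x => primitive (fun t => a t * (k * C t)) x - S x) _ _ x 0).
  - by rewrite primitive0 /S m0 mulr0 oppr0 !subrr mulr0 subrr.
  - by apply: locacB => //; exact: locac_primitive.
  apply: ae_imply2 (is_derive_primitive intaC) dm => z Dp Dm d Dd.
  have D2 := is_derive_scale 2 Dm.
  have := is_derive_add Dp (is_derive_opp (is_derive_scale (k / 2)
     (is_derive_add (is_derive_exp D2) (is_derive_opp (is_derive_exp (is_derive_opp D2)))))).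
  by move=> /(is_derive_uniq Dd) ->; rewrite /C; field.
rewrite normrM ger0_norm ?divr_ge0// ler_wpM2l ?divr_ge0//.
apply: le_trans (ler_normB _ _) _.
by rewrite !ger0_norm// expR_ge0.
Qed.

Let K (e : I -> R) := \sum_i `|e i|.

Lemma picard_step e n i x : `|picard e n.+1 i x - picard e n i x| <= (1 / 2) ^+ n * K e * C x.
Proof.
have K0 : 0 <= K e by rewrite sumr_ge0.
elim: n i x => [|n IH] i x.
  rewrite /= expr0 mul1r subr0.
  rewrite (_ : primitive _ x = 0) ?addr0; last first.
    apply/eqP; rewrite -normr_le0.
    have zC : 0 / 2 * C x = 0 by rewrite mul0r mul0r.
    (* For [k = 0] the bound is 0 and the integrand is the zero function, as is the one produced by
       the initial iterate. *)
    have := @primitive_aC 0 x (lexx 0); rewrite zC.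
    congr (`|primitive _ x| <= _); apply/funext => t.
    by rewrite mul0r mulr0 big1// => j _; rewrite mulr0.
  rewrite (@le_trans _ _ (K e))//; first by rewrite /K (bigD1 i)//= lerDl sumr_ge0.
  by rewrite -[leLHS]mulr1 ler_wpM2l.
set k := (1 / 2) ^+ n * K e in IH.
have k0 : 0 <= k by rewrite mulr_ge0// exprn_ge0// divr_ge0.
have intp n' : locint (fun t => \sum_j A i j t * picard e n' j t).
  by apply: locint_sum => j; apply: locintM_locac => //; exact: locac_picard.
rewrite (picardS e n.+1) (picardS e n) opprD addrACA subrr add0r.
have -> : (1 / 2) ^+ n.+1 * K e * C x = k / 2 * C x by rewrite exprS /k; field.
apply: le_trans (le_primitiveB (h := fun t => a t * (k * C t)) _ (intp n.+1) (intp n) _ _) _.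
- by apply: locintM_locac => //; apply: locacM => //; exact: locac_cst.
- move=> t; rewrite -sumrB.
  under eq_bigr do rewrite -mulrBr.
  by apply: row_le => j; exact: IH.
exact: primitive_aC.
Qed.

(** The increments sum to a partial geometric series. The bound does not depend on [n], so it can
    dominate the integrands in the passage to the limit. *)
Lemma picard_bound e n i x : `|picard e n i x| <= 2 * K e * C x.
Proof.
have KC : 0 <= K e * C x.
  by rewrite mulr_ge0 ?sumr_ge0// (le_trans ler01).
suff : `|picard e n i x| <= 2 * (1 - (1 / 2) ^+ n) * (K e * C x).
  move/le_trans; apply; rewrite -[leRHS]mulrA ler_wpM2r//.
  by rewrite ler_piMr// gerBl exprn_ge0// divr_ge0.
elim: n => [|n IH]; first by rewrite /= normr0 expr0 subrr mulr0 mul0r.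
have := picard_step e n i x; rewrite -mulrA => step.
rewrite -[picard e n.+1 i x](subrK (picard e n i x)).
apply: le_trans (ler_normD _ _) _; apply: le_trans (lerD step IH) _.
by rewrite exprS le_eqVlt; apply/orP; left; apply/eqP; field.
Qed.

Lemma picard_cvg e i x : cvgn (fun n => picard e n i x).
Proof.
have -> : (fun n => picard e n i x) = series (telescope (fun n => picard e n i x)).
  by rewrite telescopeK; apply/funext => n; rewrite /= subr0.
apply: normed_cvg.
apply: (@series_le_cvg _ _ (geometric (K e * C x) (1 / 2))) => //.
- by move=> n; exact: normr_ge0.
- move=> n; have : 0 <= K e * C x * (1 / 2) ^+ n 
    by rewrite mulr_ge0 ?exprn_ge0 ?divr_ge0// mulr_ge0 ?sumr_ge0// (le_trans ler01).
  by [].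
- by move=> n; apply: le_trans (picard_step e n i x) _; rewrite -mulrA mulrC.
- by apply: is_cvg_geometric_series; rewrite ger0_norm ?divr_ge0//; lra.
Qed.

(** The pointwise limit of the iterates is at first only measurable and bounded by the weight.
    Dominated convergence turns this into the integral equation, which in return gives local
    absolute continuity and the derivative almost everywhere. *)
Theorem linear_solution_exists (e : I -> R) :
  exists2 y, linear_solution y & forall i, y i 0 = e i.
Proof.
pose y i x := limn (fun n => picard e n i x).
have cvy i x : (fun n => picard e n i x) @ \oo --> y i x by exact: picard_cvg.
have y_bound i x : `|y i x| <= 2 * K e * C x.
  apply: (@closed_cvg _ _ \oo _ (fun n => `|picard e n i x|) [set z | z <= 2 * K e * C x]).
  - exact: closed_le.
  - by apply: nearW => n; exact: picard_bound.
  - by apply: cvg_norm; exact: cvy.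
have my i : measurable_fun [set: R] (y i).
  apply: (@measurable_fun_cvg _ _ _ _ (fun n x => picard e n i x)) => // n.
  by apply: locac_measurable; exact: locac_picard.
have acK : locac (fun x => 2 * K e * C x) by apply: locacM => //; exact: locac_cst.
have inty i : locint (fun x => \sum_j A i j x * y j x).
  apply: locint_sum => j; apply: locintM => // b c.
  have [M HM] := locac_bounded b c acK; exists M => x /HM.
  by apply: le_trans; apply: le_trans (y_bound j x) (ler_norm _).
have yE i x : y i x = e i + primitive (fun t => \sum_j A i j t * y j t) x.
  have cv1 : (fun n => picard e n.+1 i x) @ \oo --> y i x.
    by have := cvy i x; rewrite -(cvg_shiftS (fun n => picard e n i x)).
  have cv2 : (fun n => picard e n.+1 i x) @ \oo -->
      e i + primitive (fun t => \sum_j A i j t * y j t) x.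
    apply: cvgD; first exact: cvg_cst.
    apply: (@primitive_cvg _ (fun n t => \sum_j A i j t * picard e n j t) _
      (fun t => a t * (2 * K e * C t))) => //.
    - by move=> n; apply: locint_sum => j; apply: locintM_locac => //; exact: locac_picard.
    - exact: locintM_locac.
    - move=> t; elim: (index_enum I) => [|j s IH].
        by under eq_fun do rewrite big_nil; rewrite big_nil; exact: cvg_cst.
      under eq_fun do rewrite big_cons; rewrite big_cons.
      by apply: cvgD => //; apply: cvgM; [exact: cvg_cst|exact: cvy].
    - by move=> n t; apply: row_le => j; exact: picard_bound.
  by have := cvg_unique _ cv1 cv2; apply.
have yEf i : y i = (fun x => e i + primitive (fun t => \sum_j A i j t * y j t) x).
  by apply/funext => x; exact: yE.
exists y; last by move=> i; rewrite yE primitive0 addr0.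
split.
  by move=> i; rewrite yEf; apply: locacD; [exact: locac_cst|exact: locac_primitive].
apply: ae_forall_fin => i; apply: ae_imply (is_derive_primitive (inty i)) => x Dp.
rewrite [X in is_derive _ _ X _]yEf -[X in is_derive _ _ _ X]add0r.
by apply: is_derive_add => //; exact: is_derive_cst.
Qed.


End LinearODE.

(** * Complex-valued functions and wave functions *)

Local Notation Re := complex.Re.
Local Notation Im := complex.Im.

Section ComplexCalculus.
Variable R : realType.
Local Notation C := R[i].
Local Notation mu := (@lebesgue_measure R).
Implicit Types (f g : R -> C) (x : R) (d e u v : C).

Lemma complexP u v : Re u = Re v -> Im u = Im v -> u = v.
Proof. by case: u v => [a b] [c d] /= -> ->. Qed.

Lemma ReM u v : Re (u * v) = Re u * Re v - Im u * Im v.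
Proof. by case: u v => [a b] [c d]. Qed.

Lemma ImM u v : Im (u * v) = Re u * Im v + Im u * Re v.
Proof. by case: u v => [a b] [c d]. Qed.

Lemma ReD u v : Re (u + v) = Re u + Re v.
Proof. by case: u v => [a b] [c d]. Qed.

Lemma ImD u v : Im (u + v) = Im u + Im v.
Proof. by case: u v => [a b] [c d]. Qed.

Lemma ReN u : Re (- u) = - Re u. Proof. by case: u. Qed.

Lemma ImN u : Im (- u) = - Im u. Proof. by case: u. Qed.

Lemma abs_Re_le_normc u : `|Re u| <= Normc.normc u.
Proof. by case: u => a b /=; rewrite -sqrtr_sqr ler_wsqrtr// lerDl sqr_ge0. Qed.

Lemma abs_Im_le_normc u : `|Im u| <= Normc.normc u.
Proof. by case: u => a b /=; rewrite -sqrtr_sqr ler_wsqrtr// lerDr sqr_ge0. Qed.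

Lemma normc_le u : Normc.normc u <= `|Re u| + `|Im u|.
Proof.
case: u => a b /=; rewrite -[leRHS]ger0_norm ?addr_ge0// -sqrtr_sqr ler_wsqrtr//.
rewrite -(real_normK (num_real a)) -(real_normK (num_real b)) sqrrD lerD2r lerDl.
by rewrite mulrn_wge0// mulr_ge0.
Qed.

Definition clocac f := locac (fun t => Re (f t)) /\ locac (fun t => Im (f t)).

Lemma abs_cont_on_clocac f :
  (forall a b, a <= b -> abs_cont_on a b f) <-> clocac f.
Proof.
split=> [acf|[acR acI] a b ab e e0].
  split=> a b ab e e0; have [d d0 H] := acf a b ab e e0; exists d => // n s t st ts sd;
    apply: le_lt_trans (H n s t st ts sd); apply: ler_sum => k _.
  - by rewrite -ReN -ReD abs_Re_le_normc.
  - by rewrite -ImN -ImD abs_Im_le_normc.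
have e2 : 0 < e / 2 by rewrite divr_gt0.
have [d1 d10 H1] := acR a b ab _ e2; have [d2 d20 H2] := acI a b ab _ e2.
exists (Num.min d1 d2); first by rewrite lt_min d10.
move=> n s t st ts; rewrite lt_min => /andP[sd1 sd2].
have := ltrD (H1 n s t st ts sd1) (H2 n s t st ts sd2).
rewrite -splitr -big_split/=; apply: le_lt_trans; apply: ler_sum => k _.
by apply: le_trans (normc_le _) _; rewrite !ReD !ImD !ReN !ImN.
Qed.

Lemma clocac_cst d : clocac (fun=> d).
Proof. by split; exact: locac_cst. Qed.

Lemma clocacD f g : clocac f -> clocac g -> clocac (fun t => f t + g t).
Proof.
move=> [fR fI] [gR gI]; split.
  by under eq_fun do rewrite ReD; exact: locacD fR gR.
by under eq_fun do rewrite ImD; exact: locacD fI gI.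
Qed.

Lemma clocacN f : clocac f -> clocac (fun t => - f t).
Proof.
move=> [fR fI]; split.
  by under eq_fun do rewrite ReN; exact: locacN fR.
by under eq_fun do rewrite ImN; exact: locacN fI.
Qed.

Lemma clocacM f g : clocac f -> clocac g -> clocac (fun t => f t * g t).
Proof.
move=> [fR fI] [gR gI]; split.
  by under eq_fun do rewrite ReM; exact: locacB (locacM fR gR) (locacM fI gI).
by under eq_fun do rewrite ImM; exact: locacD (locacM fR gI) (locacM fI gR).
Qed.

(** Unlike an equation on [cderive], this relation also asserts that both parts are
    differentiable. *)
Definition is_cderive f x d :=
  is_derive x 1 (fun t => Re (f t)) (Re d) /\ is_derive x 1 (fun t => Im (f t)) (Im d).

Lemma is_cderive_cderive f x d : is_cderive f x d -> cderive f x = d.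
Proof.
by move=> [[_ dR] [_ dI]]; apply: complexP; rewrite /cderive/= derive1E.
Qed.

Lemma derivable_is_cderive f x : derivable (fun t => Re (f t)) x 1 ->
  derivable (fun t => Im (f t)) x 1 -> is_cderive f x (cderive f x).
Proof. by move=> dR dI; split; exact: derivable_is_derive. Qed.

Lemma clocac_is_cderive f : clocac f -> {ae mu, forall x, is_cderive f x (cderive f x)}.
Proof.
move=> [fR fI]; apply: ae_imply2 (locac_derivable fR) (locac_derivable fI) => x.
exact: derivable_is_cderive.
Qed.

Lemma is_cderive_cst d x : is_cderive (fun=> d) x 0.
Proof. by split; exact: is_derive_cst. Qed.

Lemma is_cderiveD f g x d e : is_cderive f x d -> is_cderive g x e ->
  is_cderive (fun t => f t + g t) x (d + e).
Proof.
move=> [fR fI] [gR gI]; split.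
  by under eq_fun do rewrite ReD; rewrite ReD; exact: is_derive_add fR gR.
by under eq_fun do rewrite ImD; rewrite ImD; exact: is_derive_add fI gI.
Qed.

Lemma is_cderiveN f x d : is_cderive f x d -> is_cderive (fun t => - f t) x (- d).
Proof.
move=> [fR fI]; split.
  by under eq_fun do rewrite ReN; rewrite ReN; exact: is_derive_opp fR.
by under eq_fun do rewrite ImN; rewrite ImN; exact: is_derive_opp fI.
Qed.

Lemma is_cderiveM f g x d e : is_cderive f x d -> is_cderive g x e ->
  is_cderive (fun t => f t * g t) x (f x * e + g x * d).
Proof.
move=> [fR fI] [gR gI]; split.
  under eq_fun do rewrite ReM.
  have := is_derive_add (is_derive_mul fR gR) (is_derive_opp (is_derive_mul fI gI)).
  by congr (is_derive _ _ _ _); rewrite ReD !ReM; ring.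
under eq_fun do rewrite ImM.
have := is_derive_add (is_derive_mul fR gI) (is_derive_mul fI gR).
by congr (is_derive _ _ _ _); rewrite ImD !ImM; ring.
Qed.

Lemma clocac_eq0 f : clocac f -> {ae mu, forall x, is_cderive f x 0} -> forall x y, f x = f y.
Proof.
move=> [fR fI] df x y; apply: complexP.
  apply: (locac_eq0 fR); apply: ae_imply df => t [dR _] d /(is_derive_uniq dR) <- //.
by apply: (locac_eq0 fI); apply: ae_imply df => t [_ dI] d /(is_derive_uniq dI) <-.
Qed.

Definition clocint f := locint (fun t => Re (f t)) /\ locint (fun t => Im (f t)).

Lemma clocint_cst d : clocint (fun=> d).
Proof. by split; exact: locint_cst. Qed.

Lemma clocintB f g : clocint f -> clocint g -> clocint (fun t => f t - g t).
Proof.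
move=> [fR fI] [gR gI]; split.
  by under eq_fun do rewrite ReD ReN; exact: locintD fR (locintN gR).
by under eq_fun do rewrite ImD ImN; exact: locintD fI (locintN gI).
Qed.

Lemma clocint_scale d f : clocint f -> clocint (fun t => d * f t).
Proof.
move=> [fR fI].
have sc (k : R) h : locint h -> locint (fun t => k * h t).
  move=> ih; under eq_fun do rewrite mulrC.
  exact: locintM_locac ih (locac_cst k).
split.
  by under eq_fun do rewrite ReM; exact: locintD (sc _ _ fR) (locintN (sc _ _ fI)).
by under eq_fun do rewrite ImM; exact: locintD (sc _ _ fI) (sc _ _ fR).
Qed.

End ComplexCalculus.

Lemma ord2P (P : 'I_2 -> Prop) : P 0 -> P 1 -> forall j, P j.
Proof.
move=> P0 P1 [[|[|[]]]//= p]; first by rewrite (_ : Ordinal p = 0)//; exact/val_inj.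
by rewrite (_ : Ordinal p = 1)//; exact/val_inj.
Qed.

Lemma big_ord2 (V : nmodType) (F : 'I_2 -> V) : \sum_k F k = F 0 + F 1.
Proof.
by rewrite !big_ord_recl big_ord0 addr0; congr (F _ + F _); exact/val_inj.
Qed.

(** * Wave functions as solutions of a linear system, and their Wronskian *)

Section WaveFunctions.
Variables (R : realType) (Q : R -> 'M[R[i]]_2) (z : R[i]).
Local Notation C := R[i].
Local Notation mu := (@lebesgue_measure R).
Hypothesis intQ : L1loc_mx Q.
Implicit Types (Psi Phi : R -> 'cV[C]_2) (x : R).

(** The diagonal of [- i sigma3], which is the inverse of [i sigma3]. *)
Definition sgni (j : 'I_2) : C := if j == 0 then - 'i%C else 'i%C.

Lemma sgni_sqr j : sgni j * sgni j = -1.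
Proof. by rewrite /sgni; case: ifP => _; rewrite ?mulrNN -expr2 sqr_i. Qed.

(* The system [i sigma3 Psi' + Q Psi = z Psi] in the form [Psi' = B Psi]. *)
Definition sysmx x (j k : 'I_2) : C := sgni j * (z *+ (j == k) - Q x j k).

Lemma sysmxE Psi x j : \sum_k sysmx x j k * Psi x k 0 =
  sgni j * (z * Psi x j 0 - \sum_k Q x j k * Psi x k 0).
Proof.
rewrite /sysmx; under eq_bigr do rewrite -mulrA mulrBl.
rewrite -mulr_sumr sumrB (bigD1 j)//= eqxx big1 ?addr0// => k /negPf kj.
by rewrite eq_sym kj mul0r.
Qed.

Lemma DopE Psi x j : Dop Q Psi x j 0 =
  - sgni j * cderive (fun t => Psi t j 0) x + \sum_k Q x j k * Psi x k 0.
Proof.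
rewrite /Dop !mxE; congr (_ + _); rewrite (bigD1 j)//= big1 ?addr0; last first.
  by move=> k kj; rewrite !mxE eq_sym (negPf kj) mul0r.
rewrite !mxE eqxx mulrA; congr (_ * _); rewrite /sgni.
by case: ifP => _; rewrite ?opprK ?mulr1 ?mulrN1.
Qed.

Lemma Dop_eq Psi x j : (Dop Q Psi x j 0 = z * Psi x j 0) <->
  cderive (fun t => Psi t j 0) x = \sum_k sysmx x j k * Psi x k 0.
Proof.
rewrite DopE sysmxE; set T := \sum_k _; set d := cderive _ _.
have s2 := sgni_sqr j; set s := sgni j in s2 *.
split=> [<-|->].
  by rewrite addrK mulrA mulrN s2 opprK mul1r.
by rewrite mulrA mulNr s2 opprK mul1r subrK.
Qed.

(** Absolute continuity makes [cderive] a true derivative almost everywhere, so the differential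
    equation can be combined with the rules of calculus. *)
Lemma wave_functionP Psi : wave_function Q z Psi <->
  (forall j, clocac (fun t => Psi t j 0)) /\
  {ae mu, forall x, forall j, is_cderive (fun t => Psi t j 0) x (\sum_k sysmx x j k * Psi x k 0)}.
Proof.
have acP : ACloc Psi <-> forall j, clocac (fun t => Psi t j 0).
  split=> [ac j|ac a b j ab].
    by apply/abs_cont_on_clocac => a b; exact: ac.
  by have /abs_cont_on_clocac := ac j; exact.
split=> -[ac eqn].
  have {}ac := acP.1 ac; split=> //.
  apply: ae_imply2 (ae_forall_fin (fun j => clocac_is_cderive (ac j))) eqn => x Dx Ex j.
  by rewrite -(Dop_eq Psi x j).1//; rewrite Ex mxE.
split; first exact/acP.
apply: ae_imply eqn => x Dx; apply/matrixP => j k; rewrite ord1 [RHS]mxE.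
by apply/Dop_eq; exact: is_cderive_cderive.
Qed.

Lemma wave_functionD (u v : C) Psi Phi : wave_function Q z Psi -> wave_function Q z Phi ->
  wave_function Q z (fun x => u *: Psi x + v *: Phi x).
Proof.
move=> /wave_functionP[ac1 D1] /wave_functionP[ac2 D2]; apply/wave_functionP.
have E j : (fun t => (u *: Psi t + v *: Phi t) j 0) = (fun t => u * Psi t j 0 + v * Phi t j 0).
  by apply/funext => t; rewrite !mxE.
split=> [j|].
  by rewrite E; apply: clocacD; apply: clocacM => //; exact: clocac_cst.
apply: ae_imply2 D1 D2 => x D1 D2 j; rewrite E.
have := is_cderiveD (is_cderiveM (is_cderive_cst u x) (D1 j)) (is_cderiveM (is_cderive_cst v x) (D2 j)).
congr (is_cderive _ _ _); rewrite !mulr0 !addr0 !mulr_sumr -big_split/=.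
by apply: eq_bigr => k _; rewrite !mxE; ring.
Qed.

(** Multiplication by a complex [b] acts on real and imaginary parts by the rows [(Re b, - Im b)]
    and [(Im b, Re b)]; the boolean [true] marks the imaginary part. *)
Definition sysmxR (p q : 'I_2 * bool) (x : R) : R :=
  let b := sysmx x p.1 q.1 in
  if p.2 == q.2 then Re b else if p.2 then Im b else - Im b.

Lemma clocint_sysmx j k : clocint (fun x => sysmx x j k).
Proof.
apply: clocint_scale; apply: clocintB; first exact: clocint_cst.
by have [iR iI] := intQ j k; split; exact: locally_integrable_locint.
Qed.

Lemma locint_sysmxR p q : locint (sysmxR p q).
Proof.
have [iR iI] := clocint_sysmx p.1 q.1; rewrite /sysmxR.
by case: (_ == _) => //; case: p.2 => //; exact: locintN.
Qed.

Lemma sum_pairE (F : 'I_2 * bool -> R) : \sum_q F q = \sum_k (F (k, false) + F (k, true)).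
Proof.
have -> : \sum_q F q = \sum_k \sum_b F (k, b) by rewrite pair_bigA; apply: eq_bigr => -[].
by apply: eq_bigr => k _; rewrite big_bool/= addrC.
Qed.

Definition components Psi (p : 'I_2 * bool) (x : R) : R :=
  if p.2 then Im (Psi x p.1 0) else Re (Psi x p.1 0).

Lemma Re_sum (F : 'I_2 -> C) : Re (\sum_k F k) = \sum_k Re (F k).
Proof. by elim/big_rec2: _ => // k a b _ <-; rewrite ReD. Qed.

Lemma Im_sum (F : 'I_2 -> C) : Im (\sum_k F k) = \sum_k Im (F k).
Proof. by elim/big_rec2: _ => // k a b _ <-; rewrite ImD. Qed.

Lemma wave_function_components Psi :
  wave_function Q z Psi <-> linear_solution sysmxR (components Psi).
Proof.
have sR x j : Re (\sum_k sysmx x j k * Psi x k 0) =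
    \sum_q sysmxR (j, false) q x * components Psi q x.
  rewrite Re_sum sum_pairE; apply: eq_bigr => k _.
  by rewrite ReM /sysmxR /components/= mulNr.
have sI x j : Im (\sum_k sysmx x j k * Psi x k 0) =
    \sum_q sysmxR (j, true) q x * components Psi q x.
  rewrite Im_sum sum_pairE; apply: eq_bigr => k _.
  by rewrite ImM /sysmxR /components/= addrC.
split=> [/wave_functionP[ac D]|[ac D]].
  split=> [[j []]|]; [exact: (ac j).2|exact: (ac j).1|].
  apply: ae_imply D => x D [j []]; [rewrite -sI; exact: (D j).2|rewrite -sR; exact: (D j).1].
apply/wave_functionP; split=> [j|].
  by split; [exact: ac (j, false)|exact: ac (j, true)].
by apply: ae_imply D => x D j; split; [rewrite sR; exact: D (j, false)|rewrite sI; exact: D (j, true)].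
Qed.

Lemma wave_function_eq0 Psi x0 : wave_function Q z Psi -> Psi x0 = 0 -> forall x, Psi x = 0.
Proof.
move=> /wave_function_components sol P0 x.
have H := linear_solution_eq0 locint_sysmxR (x0 := x0) sol.
apply/matrixP => j k; rewrite ord1 !mxE.
have {}H p : components Psi p x = 0.
  by apply: H => -[i b]; rewrite /components P0 mxE; case: b.
by apply: complexP; [exact: H (j, false)|exact: H (j, true)].
Qed.

Lemma wave_function_exists (v : 'cV[C]_2) : exists2 Psi, wave_function Q z Psi & Psi 0 = v.
Proof.
have [y soly y0] := linear_solution_exists locint_sysmxR
  (fun p => if p.2 then Im (v p.1 0) else Re (v p.1 0)).
exists (fun x => \col_j (y (j, false) x +i* y (j, true) x)%C).
  apply/wave_function_components; congr (linear_solution _ _): soly.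
  by apply/funext => -[j b]; apply/funext => x; rewrite /components mxE; case: b.
by apply/matrixP => j k; rewrite ord1 mxE !y0/=; case: (v j 0).
Qed.

(** Liouville's formula: in the product rule the off-diagonal entries of [B] meet products that
    cancel, and the two diagonal occurrences of [z] carry opposite signs. *)
Lemma wronskian_derive Psi Phi : wave_function Q z Psi -> wave_function Q z Phi ->
  clocac (fun x => wronskian (Psi x) (Phi x)) /\
  {ae mu, forall x, is_cderive (fun x => wronskian (Psi x) (Phi x)) x
    ('i%C * (Q x 0 0 - Q x 1 1) * wronskian (Psi x) (Phi x))}.
Proof.
move=> /wave_functionP[ac1 D1] /wave_functionP[ac2 D2]; split.
  by apply: clocacD; [|apply: clocacN]; exact: clocacM.
apply: ae_imply2 D1 D2 => x D1 D2.
have := is_cderiveD (is_cderiveM (D1 0) (D2 1)) (is_cderiveN (is_cderiveM (D1 1) (D2 0))).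
congr (is_cderive _ _ _); rewrite !big_ord2 /sysmx /sgni /wronskian /=.
by rewrite mulr1n mulr0n; ring.
Qed.

End WaveFunctions.

(** * Comparison of the three statements *)

Section Equivalences.
Variables (R : realType) (Q : R -> 'M[R[i]]_2).
Local Notation C := R[i].
Local Notation mu := (@lebesgue_measure R).
Implicit Types (Psi Phi : R -> 'cV[C]_2) (x : R).

(* Holds without differentiability, since the junk value of the derivative is 0. *)
Lemma derive1_opp (f : R -> R) x : derive1 (fun t => - f t) x = - derive1 f x.
Proof.
rewrite !derive1E; have [df|ndf] := pselect (derivable f x 1); first exact: deriveN.
have ndNf : ~ derivable (fun t => - f t) x 1.
  move=> /derivableN; rewrite (_ : - _ = f) => // .
  by apply/funext => t; rewrite opprfctE opprK.
by rewrite /derive (dvgP ndf) (dvgP ndNf) oppr0.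
Qed.

Lemma conjcD (u v : C) : conjc (u + v) = conjc u + conjc v.
Proof. exact: rmorphD. Qed.

Lemma conjcM (u v : C) : conjc (u * v) = conjc u * conjc v.
Proof. exact: rmorphM. Qed.

Lemma cderive_conj (f : R -> C) x : cderive (fun t => conjc (f t)) x = conjc (cderive f x).
Proof.
rewrite /cderive/=; congr (_ +i* _)%C; last rewrite -derive1_opp; congr (derive1 _ x);
  by apply/funext => t; case: (f t).
Qed.

Lemma JopE Psi x j : Jop Psi x j 0 = conjc (Psi x (1 - j) 0).
Proof.
rewrite /Jop mxE big_ord2 !mxE.
by elim/ord2P: j; rewrite ?subr0 ?subrr /= ?mul1r ?mul0r ?add0r ?addr0.
Qed.

Lemma DadjE Psi x j : Dadj Q Psi x j 0 =
  - sgni R j * cderive (fun t => Psi t j 0) x + \sum_k conjc (Q x k j) * Psi x k 0.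
Proof.
have -> : Dadj Q Psi x = Dop (fun t => adjm (Q t)) Psi x by [].
by rewrite DopE; congr (_ + _); apply: eq_bigr => k _; rewrite !mxE.
Qed.

(** Conjugation sends [i] to [- i], and [sigma1 sigma3 sigma1 = - sigma3]; the two signs cancel. The
    derivative term is thus that of the adjoint, and only the matrix terms remain to be compared.
    The index [1 - j] is the swap made by [sigma1]. *)
Lemma Jop_Dop_JopE Psi x j : Jop (Dop Q (Jop Psi)) x j 0 =
  - sgni R j * cderive (fun t => Psi t j 0) x +
  \sum_k conjc (Q x (1 - j) (1 - k)) * Psi x k 0.
Proof.
rewrite JopE DopE conjcD conjcM; congr (_ * _ + _).
- by elim/ord2P: j; apply: complexP; rewrite /sgni /= ?opprK ?oppr0.
- rewrite -cderive_conj; congr (cderive _ x); apply/funext => t.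
  by rewrite JopE conjcK subKr.
rewrite !big_ord2 conjcD !conjcM !JopE !conjcK subrr subr0 addrC.
by elim/ord2P: j; rewrite ?subrr ?subr0.
Qed.

Lemma Jop_Dop_Jop_eq Psi x : Q x 0 0 = Q x 1 1 -> Jop (Dop Q (Jop Psi)) x = Dadj Q Psi x.
Proof.
move=> Qx; apply/matrixP => j k; rewrite ord1 Jop_Dop_JopE DadjE; congr (_ + _).
rewrite !big_ord2.
by elim/ord2P: j; rewrite !subr0 !subrr Qx.
Qed.

Lemma formally_J_selfadjointP :
  formally_J_selfadjoint Q <-> {ae mu, forall x, Q x 0 0 = Q x 1 1}.
Proof.
split=> [JQ|Qeq Psi acPsi]; last first.
  by apply: ae_imply Qeq => x; exact: Jop_Dop_Jop_eq.
(* The off-diagonal entries of the two matrices always agree and their diagonals are swapped, so the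
   first component for the first basis vector already carries the whole condition. *)
pose Psi : R -> 'cV[C]_2 := fun=> \col_j (j == 0)%:R.
have acPsi : ACloc Psi.
  move=> a b j ab; apply: (abs_cont_on_clocac _).2 => //.
  rewrite (_ : (fun x => _) = fun=> (j == 0)%:R); first exact: clocac_cst.
  by apply/funext => x; rewrite mxE.
apply: ae_imply (JQ Psi acPsi) => x /matrixP/(_ 0 0).
rewrite Jop_Dop_JopE DadjE => /addrI.
rewrite !big_ord2.
rewrite !mxE !subr0 /= !mulr0 !addr0 !mulr1 => H.
by apply: esym; apply: (can_inj (@conjcK R)).
Qed.

Definition constant_wronskians := forall (z : C) Psi Phi,
  wave_function Q z Psi -> wave_function Q z Phi -> lin_indep2 Psi Phi ->
  exists2 c : C, c != 0 & forall x, wronskian (Psi x) (Phi x) = c.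

(** The coefficients [G_k] and [- F_k] annihilate coordinate [k] identically and the other one
    because the Wronskian vanishes; [k] is chosen with [F_k] nonzero, and [F = 0] is treated
    apart. *)
Lemma wronskian_eq0 (F G : 'cV[C]_2) : wronskian F G = 0 ->
  exists u v : C, (u, v) <> (0, 0) /\ u *: F + v *: G = 0.
Proof.
rewrite /wronskian => W0.
have col0 (H : 'cV[C]_2) : H 0 0 = 0 -> H 1 0 = 0 -> H = 0.
  by move=> H0 H1; apply/matrixP => j k; rewrite ord1 mxE; elim/ord2P: j.
have [F0|F0] := eqVneq (F 0 0) 0; have [F1|F1] := eqVneq (F 1 0) 0.
- exists 1, 0; split; first by case=> /eqP; rewrite oner_eq0.
  by rewrite scale0r addr0 scale1r; exact: col0.
- exists (G 1 0), (- F 1 0); split; first by case=> _ /eqP; rewrite oppr_eq0 (negPf F1).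
  apply: col0; rewrite !mxE; last by ring.
  by move: W0; rewrite F0 => /eqP; rewrite mul0r sub0r => /eqP W0; rewrite mulr0 add0r mulNr.
- exists (G 0 0), (- F 0 0); split; first by case=> _ /eqP; rewrite oppr_eq0 (negPf F0).
  apply: col0; rewrite !mxE; first by ring.
  by rewrite -[RHS]oppr0 -W0; ring.
- exists (G 0 0), (- F 0 0); split; first by case=> _ /eqP; rewrite oppr_eq0 (negPf F0).
  apply: col0; rewrite !mxE; first by ring.
  by rewrite -[RHS]oppr0 -W0; ring.
Qed.

Lemma constant_wronskiansP : L1loc_mx Q ->
  {ae mu, forall x, Q x 0 0 = Q x 1 1} <-> constant_wronskians.
Proof.
move=> intQ; split=> [Qeq z Psi Phi wPsi wPhi indep|cW].
  have [acW dW] := wronskian_derive wPsi wPhi.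
  have W_cst : forall x y, wronskian (Psi x) (Phi x) = wronskian (Psi y) (Phi y).
    apply: clocac_eq0 => //; apply: ae_imply2 Qeq dW => x ->.
    by rewrite subrr mulr0 mul0r.
  exists (wronskian (Psi 0) (Phi 0)) => [|x]; last exact: W_cst.
  apply/eqP => /wronskian_eq0[u [v [uv0 uv]]]; apply: uv0.
  have wD := wave_functionD u v wPsi wPhi.
  by have [-> ->] := indep u v (wave_function_eq0 intQ wD uv).
have [Psi wPsi Psi0] := wave_function_exists 0 intQ (\col_j (j == 0)%:R).
have [Phi wPhi Phi0] := wave_function_exists 0 intQ (\col_j (j == 1)%:R).
have indep : lin_indep2 Psi Phi.
  move=> u v /(_ 0) /matrixP uv; have := uv 1 0; have := uv 0 0.
  by rewrite !mxE Psi0 Phi0 !mxE /= !mulr0 !mulr1 addr0 add0r.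
have [c c0 Wc] := cW 0 Psi Phi wPsi wPhi indep.
have [_ dW] := wronskian_derive wPsi wPhi.
(* The Wronskian has derivative 0 as a constant and [i (Q11 - Q22) c] by the differential equation,
   where [c] and [i] are nonzero. *)
apply: ae_imply dW => x; rewrite (_ : (fun x => _) = fun=> c); last exact/funext.
move=> /is_cderive_cderive; rewrite (is_cderive_cderive (is_cderive_cst c x)) Wc.
move=> /esym/eqP; rewrite !mulf_eq0 (negPf c0) orbF subr_eq0 => /orP[|/eqP//].
by rewrite eq_complex /= oner_eq0 andbF.
Qed.

End Equivalences.

Theorem theorem2p1 (R : realType) (Q : R -> 'M[R[i]]_2) :
  L1loc_mx Q ->
  [/\ (formally_J_selfadjoint Q <-> {ae lebesgue_measure, forall x, Q x 0 0 = Q x 1 1}),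
      ({ae lebesgue_measure, forall x, Q x 0 0 = Q x 1 1} <->
         forall (z : R[i]) (Psi Phi : R -> 'cV[R[i]]_2),
           wave_function Q z Psi -> wave_function Q z Phi -> lin_indep2 Psi Phi ->
           exists2 c : R[i], c != 0 & forall x, wronskian (Psi x) (Phi x) = c)
    & (formally_J_selfadjoint Q <->
         forall (z : R[i]) (Psi Phi : R -> 'cV[R[i]]_2),
           wave_function Q z Psi -> wave_function Q z Phi -> lin_indep2 Psi Phi ->
           exists2 c : R[i], c != 0 & forall x, wronskian (Psi x) (Phi x) = c)].
Proof.
move=> intQ; have JQ := formally_J_selfadjointP Q; have WQ := constant_wronskiansP intQ.
by split=> //; exact: iff_trans JQ WQ.
Qed.
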